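(* Let $m\ge 2$ and $k$ be integers with $2\le k\le m$. Let $\mathcal B=\mathcal B_{m,k}$ be the associative $\mathbb C$-algebra generated by $x_1,\ldots,x_m$ subject to the defining relations $$\sum_{\sigma\in S_k}\operatorname{sgn}(\sigma)\, x_{i_{\sigma(1)}}x_{i_{\sigma(2)}}\cdots x_{i_{\sigma(k)}}=0\qquad\text{for all }1\le i_1<i_2<\cdots<i_k\le m .$$ Call a finite sequence $\mathbf i=(i_1,\ldots,i_\ell)$ with entries in $\{1,\ldots,m\}$ (including the empty sequence) admissible if it contains no $k$ consecutive entries $i_s>i_{s+1}>\cdots>i_{s+k-1}$ that are strictly decreasing; let $\Lambda(m,k)$ be the set of admissible sequences. The admissible monomials $M_{\mathbf i}(X)=x_{i_1}\cdots x_{i_\ell}$, $\mathbf i\in\Lambda(m,k)$, form a linear basis of $\mathcal B$. Let $A=(a_{ij})$ be a complex $m\times m$ matrix, set $y_i=a_{i1}x_1+\cdots+a_{im}x_m$ and $M_{\mathbf i}(AX)=y_{i_1}\cdots y_{i_\ell}\in\mathcal B$. For $\mathbf i\in\Lambda(m,k)$ let $G(\mathbf i)$ be the coefficient of $M_{\mathbf i}(X)$ in the expansion of $M_{\mathbf i}(AX)$ in the basis of admissible monomials, with $G(\varnothing)=1$. Let $t_1,\ldots,t_m$ be commuting variables, $T=\mathrm{diag}(t_1,\ldots,t_m)$, and define $c_r(TA)\in\mathbb C[t_1,\ldots,t_m]$ by $\det(\lambda I-TA)=\sum_{r=0}^m c_r(TA)\lambda^{m-r}$. Then, as formal power series in $t_1,\ldots,t_m$,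 $$\Bigl(\sum_{(i_1,\ldots,i_\ell)\in\Lambda(m,k)} G(i_1,\ldots,i_\ell)\,t_{i_1}\cdots t_{i_\ell}\Bigr)\cdot\Bigl(\sum_{\substack{0\le r\le m\\ r\equiv 0 \text{ or } 1 \ (\mathrm{mod}\ k)}}(-1)^{\alpha(r)}c_r(TA)\Bigr)=1,$$ where $\alpha(r)=r-(r\bmod k)$ and $(r \bmod k)\in\{0,\dots,k-1\}$ is the remainder.
   Context: The empty sequence is admissible and contributes the term $G(\varnothing)\cdot 1=1$ to the first sum. $\operatorname{sgn}(\sigma)$ denotes the sign of the permutation $\sigma$. *)

(* Defs.v *)
From HB Require Import structures.
From mathcomp Require Import all_boot all_algebra generic_quotient perm.
From mathcomp Require Import finmap.
From mathcomp Require Import boolp classical_sets reals complex.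
From mathcomp Require Import -(notations) monalg.
From mathcomp Require Import mpoly.

Set Implicit Arguments.
Unset Strict Implicit.
Unset Printing Implicit Defensive.

Import GRing.Theory.
Local Open Scope ring_scope.
Local Open Scope quotient_scope.

Section IdealQuotient.
Variables (K : comNzRingType) (A : algType K) (S : A -> Prop).

Inductive two_sided_ideal : A -> Prop :=
| tsi0 : two_sided_ideal 0
| tsiD p q : two_sided_ideal p -> two_sided_ideal q -> two_sided_ideal (p + q)
| tsiM a r b : S r -> two_sided_ideal (a * r * b).

Lemma tsiMl a p : two_sided_ideal p -> two_sided_ideal (a * p).
Proof.
elim=> [|q r _ Iq _ Ir|c r b Sr]; first by rewrite mulr0; constructor.
  by rewrite mulrDr; constructor.
by rewrite !mulrA; constructor.
Qed.

Lemma tsiMr a p : two_sided_ideal p -> two_sided_ideal (p * a).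
Proof.
elim=> [|q r _ Iq _ Ir|c r b Sr]; first by rewrite mul0r; constructor.
  by rewrite mulrDl; constructor.
by rewrite -mulrA; constructor.
Qed.

Lemma tsiZ c p : two_sided_ideal p -> two_sided_ideal (c *: p).
Proof. by rewrite -mulr_algl; apply: tsiMl. Qed.

Definition idealb : {pred A} := fun p => `[< two_sided_ideal p >].

Lemma idealb_zmod_closed : zmod_closed idealb.
Proof.
split=> [|p q /asboolP Ip /asboolP Iq]; apply/asboolP; first by constructor.
by apply: tsiD => //; rewrite -scaleN1r; apply: tsiZ.
Qed.

HB.instance Definition _ := GRing.isZmodClosed.Build A idealb idealb_zmod_closed.

Definition algquot := {ideal_quot idealb}.

HB.instance Definition _ := Choice.on algquot.
HB.instance Definition _ := GRing.Zmodule.on algquot.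

Definition quotpi : A -> algquot := \pi_({ideal_quot idealb}).

Lemma quotpi_eqP p q : quotpi p = quotpi q <-> two_sided_ideal (p - q).
Proof.
rewrite /quotpi; split=> [/eqP|I].
  by rewrite -Quotient.idealrBE => /asboolP.
by apply/eqP; rewrite -Quotient.idealrBE; apply/asboolP.
Qed.

Lemma quotpi_repr (u : algquot) : quotpi (repr u) = u.
Proof. exact: reprK. Qed.

Lemma quotpiD p q : quotpi (p + q) = quotpi p + quotpi q.
Proof. by rewrite /quotpi !piE. Qed.

Definition qone : algquot := quotpi 1.
Definition qmul (u v : algquot) : algquot := quotpi (repr u * repr v).
Definition qscale (c : K) (u : algquot) : algquot := quotpi (c *: repr u).

Lemma reprB p : two_sided_ideal (repr (quotpi p) - p).
Proof. by apply/quotpi_eqP; rewrite quotpi_repr. Qed.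

Lemma qmulE p q : quotpi (p * q) = qmul (quotpi p) (quotpi q).
Proof.
apply/esym/quotpi_eqP.
set p' := repr _; set q' := repr _.
have -> : p' * q' - p * q = (p' - p) * q' + p * (q' - q).
  by rewrite mulrBl mulrBr addrA subrK.
by apply: tsiD; [apply: tsiMr | apply: tsiMl]; apply: reprB.
Qed.

Lemma qscaleE c p : quotpi (c *: p) = qscale c (quotpi p).
Proof.
by apply/esym/quotpi_eqP; rewrite -scalerBr; apply: tsiZ; apply: reprB.
Qed.

Lemma qmulA : associative qmul.
Proof.
move=> u v w; rewrite -(quotpi_repr u) -(quotpi_repr v) -(quotpi_repr w).
by rewrite -!qmulE mulrA.
Qed.

Lemma qmul1 : left_id qone qmul.
Proof. by move=> u; rewrite -(quotpi_repr u) -qmulE mul1r. Qed.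

Lemma qmulr1 : right_id qone qmul.
Proof. by move=> u; rewrite -(quotpi_repr u) -qmulE mulr1. Qed.

Lemma qmulDl : left_distributive qmul +%R.
Proof.
move=> u v w; rewrite -(quotpi_repr u) -(quotpi_repr v) -(quotpi_repr w).
by rewrite -quotpiD -!qmulE -quotpiD mulrDl.
Qed.

Lemma qmulDr : right_distributive qmul +%R.
Proof.
move=> u v w; rewrite -(quotpi_repr u) -(quotpi_repr v) -(quotpi_repr w).
by rewrite -quotpiD -!qmulE -quotpiD mulrDr.
Qed.

(* The quotient is the zero ring when 1 lies in the ideal, whereas [algType]
   requires 1 != 0; the two associativity laws of an algebra are therefore
   the lemmas [algquot_scalerAl] and [algquot_scalerAr]. *)
HB.instance Definition _ := GRing.Zmodule_isPzRing.Build algquot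
  qmulA qmul1 qmulr1 qmulDl qmulDr.

Lemma qscaleA a b u : qscale a (qscale b u) = qscale (a * b) u.
Proof. by rewrite -(quotpi_repr u) -!qscaleE scalerA. Qed.

Lemma qscale1 : left_id 1 qscale.
Proof. by move=> u; rewrite -(quotpi_repr u) -qscaleE scale1r. Qed.

Lemma qscaleDr : right_distributive qscale +%R.
Proof.
move=> a u v; rewrite -(quotpi_repr u) -(quotpi_repr v).
by rewrite -quotpiD -!qscaleE -quotpiD scalerDr.
Qed.

Lemma qscaleDl u : {morph qscale^~ u : a b / a + b}.
Proof.
by move=> a b /=; rewrite -(quotpi_repr u) -!qscaleE -quotpiD scalerDl.
Qed.

HB.instance Definition _ := GRing.Zmodule_isLmodule.Build K algquot
  qscaleA qscale1 qscaleDr qscaleDl.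

Lemma algquot_scalerAl c (u v : algquot) : c *: (u * v) = (c *: u) * v.
Proof.
rewrite -(quotpi_repr u) -(quotpi_repr v).
change (qscale c (qmul (quotpi (repr u)) (quotpi (repr v))) =
  qmul (qscale c (quotpi (repr u))) (quotpi (repr v))).
by rewrite -qmulE -!qscaleE -qmulE scalerAl.
Qed.

Lemma algquot_scalerAr c (u v : algquot) : c *: (u * v) = u * (c *: v).
Proof.
rewrite -(quotpi_repr u) -(quotpi_repr v).
change (qscale c (qmul (quotpi (repr u)) (quotpi (repr v))) =
  qmul (quotpi (repr u)) (qscale c (quotpi (repr v)))).
by rewrite -qmulE -!qscaleE -qmulE scalerAr.
Qed.

Lemma quotpi_zmod_morphism : zmod_morphism quotpi.
Proof. by move=> p q; rewrite /quotpi !piE. Qed.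
HB.instance Definition _ :=
  GRing.isZmodMorphism.Build A algquot quotpi quotpi_zmod_morphism.

Lemma quotpi_monoid_morphism : monoid_morphism quotpi.
Proof. by split=> // p q; apply: qmulE. Qed.
HB.instance Definition _ :=
  GRing.isMonoidMorphism.Build A algquot quotpi quotpi_monoid_morphism.

HB.instance Definition _ :=
  GRing.isScalable.Build K A algquot *:%R quotpi qscaleE.

End IdealQuotient.

Section FreeAlgebra.
Variables (K : comNzRingType) (m : nat).

Definition freealg := malg (fmonom 'I_m) K.

HB.instance Definition _ := GRing.Lalgebra.on freealg.

Lemma freealg_scalerAr c (p q : freealg) : c *: (p * q) = p * (c *: q).
Proof.
have malgC_comm (r : malg (fmonom 'I_m) K) : mkmalgU mone c * r = r * mkmalgU mone c.
  rewrite !malgM_def fgmulUg fgmulgU; apply: eq_bigr => w _.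
  by rewrite mul1m mulm1 mulrC.
rewrite /freealg in p q *.
by rewrite -!mul_malgC mulrA malgC_comm -mulrA.
Qed.

HB.instance Definition _ :=
  GRing.Lalgebra_isAlgebra.Build K freealg freealg_scalerAr.

Definition fvar (i : 'I_m) : freealg := mkmalgU (fmu i) 1.

End FreeAlgebra.

Section BasisExpansion.
Variables (K : nzRingType) (V : lmodType K) (I : choiceType).
Variables (P : {pred I}) (b : I -> V).

Definition lincomb (c : {fsfun I -> K with 0}) : V :=
  \sum_(i <- finsupp c) c i *: b i.

Definition supported_on (c : {fsfun I -> K with 0}) : Prop :=
  {subset finsupp c <= P}.

(* [b] restricted to the index set [P] is a basis (in particular it is
   injective there). *)
Definition is_basis_on : Prop :=
  (forall c, supported_on c -> lincomb c = 0 -> forall i, c i = 0) /\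
  (forall v, exists2 c, supported_on c & v = lincomb c).

(* Meaningful only when [is_basis_on] holds. *)
Definition basis_coeff (v : V) : I -> K :=
  xget [fsfun] [set c | supported_on c /\ v = lincomb c]%classic.

End BasisExpansion.

Section Algebra.
Variables (K : comNzRingType) (m k : nat).

Definition alternator (u : 'I_k -> 'I_m) : freealg K m :=
  \sum_(s : 'S_k) (-1) ^+ s *: \prod_(j < k) fvar K (u (s j)).

Definition relB (p : freealg K m) : Prop :=
  exists2 u : 'I_k -> 'I_m,
    {homo u : a b / (a < b)%N} & p = alternator u.

Definition algB := algquot relB.

Definition genB (i : 'I_m) : algB := quotpi relB (fvar K i).

(* [s] has no factor of [k] consecutive strictly decreasing letters. *)
Definition admissible (s : seq 'I_m) : bool :=
  ~~ [exists w : k.-tuple 'I_m,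
        sorted (fun a b : 'I_m => (b < a)%N) w && infix w s].

Definition monB (z : 'I_m -> algB) (s : seq 'I_m) : algB := \prod_(i <- s) z i.

Definition linB (A : 'M[K]_m) (i : 'I_m) : algB := \sum_j A i j *: genB j.

Definition coeffG (A : 'M[K]_m) (s : seq 'I_m) : K :=
  basis_coeff admissible (monB genB) (monB (linB A) s) s.

End Algebra.

Section PowerSeries.
Variables (K : comNzRingType) (m : nat).

(* Formal power series in m commuting variables, as coefficient families. *)
Definition mseries := 'X_{1..m} -> K.

Definition mseries_one : mseries := fun n => (n == 0%MM)%:R.

Definition mseries_mul (f g : mseries) : mseries := fun n =>
  \sum_(a : 'X_{1..m < (mdeg n).+1} | (bmnm a <= n)%MM)
    f a * g (n - bmnm a)%MM.

Definition mseries_of_poly (p : {mpoly K[m]}) : mseries := fun n => p@_n.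

Definition word_monomial (s : seq 'I_m) : {mpoly K[m]} := \prod_(i <- s) 'X_i.

(* The infinite sum of [g s *: word_monomial s] over the words [s] in [P]: the
   term of [s] is homogeneous of degree [size s], so only the words of size
   [mdeg n] contribute to the coefficient of index [n]. *)
Definition word_series (P : pred (seq 'I_m)) (g : seq 'I_m -> K) : mseries :=
  fun n => \sum_(s : (mdeg n).-tuple 'I_m | P s)
    (g s *: word_monomial s)@_n.

Definition TA (A : 'M[K]_m) : 'M[{mpoly K[m]}]_m :=
  diag_mx (\row_i 'X_i) *m map_mx (@mpolyC m K) A.

Definition cTA (A : 'M[K]_m) (r : nat) : {mpoly K[m]} :=
  (char_poly (TA A))`_(m - r).

End PowerSeries.

Arguments mseries_one {K m} n.

(* Main.v *)
(* Write [alt f a w b] for the signed sum of [f] over the rearrangements of the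
   letters of [w] between the words [a] and [b]; functions of words for which all
   these sums vanish are functionals on the algebra B.  For every admissible word
   [z] there is a unique such functional [nf z] equal to the indicator of [z] on
   admissible words: it is built by induction on the lexicographic rank, and it is
   well defined because two overlapping decreasing factors are related by the two
   expansions (along the first and the last letter) of the alternator of k+1
   letters.  This gives the basis theorem.

   Alternators are preserved by linear substitutions, so a matrix g acts on every
   homogeneous component of B; the coefficients G t_i are the diagonal entries of
   the action of TA, and the first series is the generating function of its traces.
   Both this trace and the characteristic polynomial are invariant under
   conjugation, so by Schur's theorem g may be taken triangular.  The trace then
   becomes a sum over admissible words of products of eigenvalues, c_r becomes an
   elementary symmetric function, i.e. a sum over decreasing words, and the identity
   follows word by word: the splittings of a nonempty word into a decreasing prefix
   and an admissible suffix correspond to a window of k consecutive prefix lengths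
   (or to its nonnegative part, which then contains 0 and 1), where exactly one
   length is a multiple of k and exactly one is congruent to 1.  Finally the
   identity at all numerical values of t implies the polynomial one. *)
Require Import Defs.
From HB Require Import structures.
From mathcomp Require Import all_boot all_algebra perm.
From mathcomp Require Import finmap boolp classical_sets reals complex.
From mathcomp Require Import -(notations) monalg.
From mathcomp Require Import mpoly.
From mathcomp Require Import mxred spectral zify.
Set Implicit Arguments.
Unset Strict Implicit.
Unset Printing Implicit Defensive.
Import GRing.Theory.
Local Open Scope ring_scope.

(** * Words and alternating sums *)

Section Words.
Variable m : nat.
Implicit Types (a b v : seq 'I_m).

Definition gt_letter (x y : 'I_m) := (y < x)%N.

Lemma gt_letter_trans : transitive gt_letter.
Proof. by move=> y x z xy yz; apply: ltn_trans yz xy. Qed.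

(* The base-[m] value of a word, so that words of equal length are compared
   lexicographically. *)
Fixpoint rank v : nat :=
  if v is x :: v' then (x * m ^ size v' + rank v')%N else 0%N.

Lemma rank_lt v : (rank v < m ^ size v)%N.
Proof.
elim: v => [|x v IH]; first by rewrite expn0.
rewrite /= expnS.
have : (x.+1 * m ^ size v <= m * m ^ size v)%N by rewrite leq_mul2r ltn_ord orbT.
by lia.
Qed.

Lemma rank_cat a b : rank (a ++ b) = (rank a * m ^ size b + rank b)%N.
Proof. by elim: a => //= x a ->; rewrite size_cat expnD; lia. Qed.

(** At the first letter where the words differ, the sorted one carries the largest of the remaining
    letters, and the leading digit outweighs all later ones. *)
Lemma rank_perm_sorted a b :
  perm_eq a b -> sorted gt_letter b -> a != b -> (rank a < rank b)%N.
Proof.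
elim: b a => [|y b IH] [|x a] // ab; try by have := perm_size ab.
have [exy | nxy] := eqVneq x y; first subst x.
  move=> /path_sorted sb; rewrite eqseq_cons eqxx => /= nab.
  move: ab; rewrite perm_cons => ab.
  by rewrite /= (perm_size ab) ltn_add2l IH.
move=> sb _ /=.
have xb : x \in b.
  have : x \in y :: b by rewrite -(perm_mem ab) mem_head.
  by rewrite inE (negPf nxy).
have /allP/(_ _ xb) xy := order_path_min gt_letter_trans sb.
have [sab] : (size a).+1 = (size b).+1 := perm_size ab.
have := rank_lt a; rewrite sab => ra.
have : (x.+1 * m ^ size b <= y * m ^ size b)%N by rewrite leq_mul2r (xy : (x < y)%N) orbT.
by lia.
Qed.

Definition decr k (w : 'I_k -> 'I_m) := forall i j : 'I_k, (i < j)%N -> (w j < w i)%N.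

Definition permword k (w : 'I_k -> 'I_m) (s : 'S_k) : seq 'I_m :=
  [seq w (s j) | j <- enum 'I_k].

Lemma size_permword k (w : 'I_k -> 'I_m) s : size (permword w s) = k.
Proof. by rewrite size_map size_enum_ord. Qed.

Lemma eq_permword k (w w' : 'I_k -> 'I_m) s : w =1 w' -> permword w s = permword w' s.
Proof. by move=> e; apply: eq_map => j; rewrite e. Qed.

Lemma permword_comp k (w : 'I_k -> 'I_m) (s t : 'S_k) :
  permword (w \o s) t = permword w (t * s)%g.
Proof. by apply: eq_map => j /=; rewrite permM. Qed.

Lemma decr_inj k (w : 'I_k -> 'I_m) : decr w -> injective w.
Proof.
move=> dw i j e; apply: val_inj; have [||//] := ltngtP i j => /dw;
  by rewrite e ltnn.
Qed.

Lemma perm_permword k (w : 'I_k -> 'I_m) s : perm_eq (permword w s) (permword w 1%g).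
Proof.
rewrite /permword (map_comp w s) (map_comp w (1%g : 'S_k)) perm_map //.
have e : map (1%g : 'S_k) (enum 'I_k) = enum 'I_k.
  by rewrite -[RHS]map_id; apply: eq_map => j; rewrite perm1.
rewrite e; apply: uniq_perm; rewrite ?(map_inj_uniq perm_inj) ?enum_uniq //.
move=> i; rewrite mem_enum; apply/mapP; exists (s^-1%g i); rewrite ?mem_enum //.
by rewrite permKV.
Qed.

Lemma permword_inj k (w : 'I_k -> 'I_m) : injective w -> injective (permword w).
Proof.
move=> iw s t e; apply/permP => j; apply: iw.
have /eq_in_map := e; apply; exact: mem_enum.
Qed.

Lemma permword_nth x0 k (w : 'I_k -> 'I_m) s (j : 'I_k) :
  nth x0 (permword w s) j = w (s j).
Proof. by rewrite (nth_map j) ?size_enum_ord // nth_ord_enum. Qed.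

Lemma sorted_permword1 k (w : 'I_k -> 'I_m) : decr w -> sorted gt_letter (permword w 1%g).
Proof.
move=> dw; rewrite /permword sorted_map.
have : sorted ltn (map val (enum 'I_k)) by rewrite val_enum_ord iota_ltn_sorted.
rewrite sorted_map; apply: sub_sorted => i j /= ij.
by rewrite /= /gt_letter !perm1 dw.
Qed.

(** The decreasing arrangement is the unique leading term of its alternator, so alternators act as
    rewriting rules that lower [rank]. *)
Lemma rank_permword k (w : 'I_k -> 'I_m) s a b : decr w -> s != 1%g ->
  (rank (a ++ permword w s ++ b) < rank (a ++ permword w 1%g ++ b))%N.
Proof.
move=> dw s1; rewrite !rank_cat !size_cat !size_permword ltn_add2l ltn_add2r.
have m0 : (0 < m)%N.
  case: k w s dw s1 => [|k] w s _ s1; last exact: leq_ltn_trans (ltn_ord (w ord0)).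
  by case/negP: s1; apply/eqP/permP; case.
rewrite ltn_pmul2r ?expn_gt0 ?m0 // rank_perm_sorted ?perm_permword //.
  exact: sorted_permword1.
apply: contra_neq s1; apply: permword_inj; exact: decr_inj.
Qed.

Lemma rank_permword_le k (w : 'I_k -> 'I_m) s a b : decr w ->
  (rank (a ++ permword w s ++ b) <= rank (a ++ permword w 1%g ++ b))%N.
Proof.
by move=> dw; have [->//|s1] := eqVneq s 1%g; apply/ltnW/rank_permword.
Qed.

Lemma decr_lift k (w : 'I_k.+1 -> 'I_m) h : decr w -> decr (w \o lift h).
Proof.
move=> dw i j ij; apply: dw; rewrite /= /bump.
by case: (leqP h j) => hj; case: (leqP h i) => hi; rewrite ?add0n ?add1n ?ltnS //;
  move: hi hj ij => /=; lia.
Qed.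

Lemma permword_lift_max k (w : 'I_k.+1 -> 'I_m) j (s : 'S_k) :
  permword w (lift_perm ord_max j s) = rcons (permword (w \o lift j) s) (w j).
Proof.
rewrite /permword enum_ordSr map_rcons lift_perm_id -map_comp; congr rcons.
apply: eq_map => i /=.
have -> : widen_ord (leqnSn k) i = lift ord_max i.
  by apply: val_inj; rewrite [RHS]lift_max.
by rewrite lift_perm_lift.
Qed.

Lemma permword_lift0 k (w : 'I_k.+1 -> 'I_m) j (s : 'S_k) :
  permword w (lift_perm ord0 j s) = w j :: permword (w \o lift j) s.
Proof.
rewrite /permword enum_ordSl /= lift_perm_id -map_comp; congr cons.
by apply: eq_map => i /=; rewrite lift_perm_lift.
Qed.

(** * Alternators of words and their cofactor expansions *)

Section Alternation.
Variables (K : comNzRingType) (V : lmodType K).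
Implicit Types f : seq 'I_m -> V.

Definition alt f k a (w : 'I_k -> 'I_m) b : V :=
  \sum_(s : 'S_k) (-1) ^+ s *: f (a ++ permword w s ++ b).

Lemma eq_alt f k a (w w' : 'I_k -> 'I_m) b : w =1 w' -> alt f a w b = alt f a w' b.
Proof. by move=> e; apply: eq_bigr => s _; rewrite (eq_permword _ e). Qed.

Lemma alt_comp f k a (w : 'I_k -> 'I_m) (s : 'S_k) b :
  alt f a (w \o s) b = (-1) ^+ s *: alt f a w b.
Proof.
rewrite /alt scaler_sumr [RHS](reindex_inj (mulIg s)) /=.
apply: eq_bigr => t _; rewrite scalerA permword_comp odd_permM signr_addb.
by rewrite mulrC -mulrA -expr2 sqrr_sign mulr1.
Qed.

Lemma alt_top f k a (w : 'I_k -> 'I_m) b :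
  alt f a w b = f (a ++ permword w 1%g ++ b) +
    \sum_(s : 'S_k | s != 1%g) (-1) ^+ s *: f (a ++ permword w s ++ b).
Proof. by rewrite /alt (bigD1 (1%g : 'S_k)) //= odd_perm1 expr0 scale1r. Qed.

Lemma sum_lift_perm k (i : 'I_k.+1) (F : 'S_k.+1 -> V) :
  \sum_s F s = \sum_j \sum_(s : 'S_k) F (lift_perm i j s).
Proof.
rewrite (partition_big (fun s : 'S_k.+1 => s i) xpredT) //=; apply: eq_bigr => j _.
rewrite (reindex (lift_perm i j)) /=; last first.
  (* The inverse of [lift_perm i j] deletes [i] from the domain and [s i] from the range. *)
  pose ulsf i (s : 'S_k.+1) h := odflt h (unlift (s i) (s (lift i h))).
  have ulsfK i' (s : 'S_k.+1) h : lift (s i') (ulsf i' s h) = s (lift i' h).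
    rewrite /ulsf; have : s i' != s (lift i' h) by rewrite (inj_eq perm_inj) neq_lift.
    by case/unlift_some => ? ? ->.
  have inj_ulsf s : injective (ulsf i s).
    by move=> x y e; apply: (@lift_inj _ i); apply: (@perm_inj _ s); rewrite -!ulsfK e.
  exists (fun s => perm (inj_ulsf s)) => [s _ | s /eqP sij].
    by apply/permP=> h; rewrite permE /ulsf lift_perm_lift lift_perm_id liftK.
  apply/permP => x; case: (unliftP i x) => [y|] ->.
    by rewrite lift_perm_lift permE -sij ulsfK.
  by rewrite lift_perm_id sij.
by apply: eq_bigl => s; rewrite lift_perm_id eqxx.
Qed.

Lemma alt_last f k a (w : 'I_k.+1 -> 'I_m) b :
  alt f a w b = \sum_(j < k.+1) (-1) ^+ (k + j) *: alt f a (w \o lift j) (w j :: b).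
Proof.
rewrite {1}/alt (sum_lift_perm ord_max); apply: eq_bigr => j _.
rewrite scaler_sumr; apply: eq_bigr => s _; rewrite permword_lift_max cat_rcons scalerA.
by rewrite odd_lift_perm !signr_addb !signr_odd exprD.
Qed.

Lemma alt_first f k a (w : 'I_k.+1 -> 'I_m) b :
  alt f a w b = \sum_(j < k.+1) (-1) ^+ j *: alt f (rcons a (w j)) (w \o lift j) b.
Proof.
rewrite {1}/alt (sum_lift_perm ord0); apply: eq_bigr => j _.
rewrite scaler_sumr; apply: eq_bigr => s _; rewrite permword_lift0 cat_rcons scalerA.
by rewrite odd_lift_perm !signr_addb !signr_odd expr0 mul1r.
Qed.

End Alternation.
End Words.

(** * The alternators define a confluent rewriting system *)

Section Confluence.
Variables (m k : nat) (K : comNzRingType) (V : lmodType K).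
Implicit Types (a b v : seq 'I_m) (f : seq 'I_m -> V).

(** The induction invariant for building functionals rank by rank: the relations led by a word of
    rank below [N] already hold. *)
Definition alt_vanishes_below f N := forall a (w : 'I_k -> 'I_m) b,
  decr w -> (rank (a ++ permword w 1%g ++ b) < N)%N -> alt f a w b = 0.

(* Both expansions of the alternator of [k.+1] letters, along its last and
   along its first letter, have only one term of top rank. *)
Lemma alt_shift f a (w : 'I_k.+1 -> 'I_m) b : decr w ->
  alt_vanishes_below f (rank (a ++ permword w 1%g ++ b)) ->
  alt f a (w \o lift ord_max) (w ord_max :: b)
  = alt f (rcons a (w ord0)) (w \o lift ord0) b.
Proof.
move=> dw f0; have := alt_last f a w b; rewrite alt_first.
(* Putting another letter in front gives a smaller leading word, whose alternator already vanishes;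
   the expansion along the last letter behaves alike. *)
rewrite (bigD1 ord0) //= big1 => [|j j0]; last first.
  rewrite f0 ?scaler0 //; first exact: decr_lift.
  rewrite cat_rcons -cat_cons -permword_lift0; apply: rank_permword => //.
  by apply: contra_neq j0 => /permP/(_ ord0); rewrite lift_perm_id perm1.
rewrite (bigD1 ord_max) //= big1 => [|j j0]; last first.
  rewrite f0 ?scaler0 //; first exact: decr_lift.
  rewrite -cat_rcons -permword_lift_max; apply: rank_permword => //.
  by apply: contra_neq j0 => /permP/(_ ord_max); rewrite lift_perm_id perm1.
by rewrite !addr0 expr0 scale1r addnn -mul2n exprM sqrrN expr1n expr1n scale1r.
Qed.

(** Alternate over both factors at once: for a fixed nontrivial arrangement of one factor, the
    alternator of the other has lower rank and vanishes, so the double sum equals either side. *)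
Lemma alt_disjoint f a (w : 'I_k -> 'I_m) c (w' : 'I_k -> 'I_m) b : decr w -> decr w' ->
  alt_vanishes_below f (rank (a ++ permword w 1%g ++ c ++ permword w' 1%g ++ b)) ->
  alt f a w (c ++ permword w' 1%g ++ b) = alt f (a ++ permword w 1%g ++ c) w' b.
Proof.
move=> dw dw' f0.
pose S := \sum_(s : 'S_k) \sum_(t : 'S_k) (-1) ^+ s *: ((-1) ^+ t *:
  f (a ++ permword w s ++ c ++ permword w' t ++ b)).
transitivity S.
  rewrite /alt /S exchange_big /= [RHS](bigD1 (1%g : 'S_k)) //= [X in _ + X]big1 ?addr0 => [|t t1].
    by apply: eq_bigr => s _; rewrite odd_perm1 expr0 scale1r.
  transitivity ((-1) ^+ t *: alt f a w (c ++ permword w' t ++ b)).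
    by rewrite /alt scaler_sumr; apply: eq_bigr => s _; rewrite !scalerA mulrC.
  rewrite f0 ?scaler0 //.
  have := rank_permword (a ++ permword w 1%g ++ c) b dw' t1.
  by rewrite -!catA.
rewrite /alt /S [LHS](bigD1 (1%g : 'S_k)) //= [X in _ + X]big1 ?addr0 => [|s s1].
  by apply: eq_bigr => t _; rewrite odd_perm1 expr0 scale1r -!catA.
transitivity ((-1) ^+ s *: alt f (a ++ permword w s ++ c) w' b).
  by rewrite /alt scaler_sumr; apply: eq_bigr => t _; rewrite -!catA.
rewrite f0 ?scaler0 //.
have := rank_permword a (c ++ permword w' 1%g ++ b) dw s1.
by rewrite -!catA.
Qed.

Lemma cat_take_permword x0 v p n : (p + n <= size v)%N ->
  take p v ++ permword (fun j : 'I_n => nth x0 v (p + j)) 1%g ++ drop (p + n) v = v.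
Proof.
move=> le; rewrite -[RHS](cat_take_drop p); congr (_ ++ _).
rewrite -[RHS](cat_take_drop n) drop_drop [(n + p)%N]addnC; congr (_ ++ _).
have sz : size (take n (drop p v)) = n by rewrite size_takel // size_drop; lia.
apply: (@eq_from_nth _ x0); rewrite size_permword ?sz // => r lt.
by rewrite -[r]/(nat_of_ord (Ordinal lt)) permword_nth perm1 nth_take // nth_drop.
Qed.

(** Induction on the distance of the two windows. At distance at least [k] they are disjoint;
    otherwise they overlap, and the left one moves one step right by [alt_shift]. *)
Lemma alt_confluent_nth x0 f v p q (dec := fun p => (p + k <= size v)%N /\
    decr (fun j : 'I_k => nth x0 v (p + j))) :
  alt_vanishes_below f (rank v) -> (p <= q)%N -> dec p -> dec q ->
  alt f (take p v) (fun j : 'I_k => nth x0 v (p + j)) (drop (p + k) v)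
  = alt f (take q v) (fun j : 'I_k => nth x0 v (q + j)) (drop (q + k) v).
Proof.
move=> f0 pq; rewrite -(subnKC pq); move: (q - p)%N => {q pq} d.
elim: d p => [|d IH] p [sp dp] [sq dq]; first by rewrite addn0.
have [kd | dk] := leqP k d.+1.
  set w := fun _ => _; set w' := fun _ => _; set q := (p + d.+1)%N.
  set c := drop (p + k) (take q v).
  have eq_c : take p v ++ permword w 1%g ++ c = take q v.
    rewrite -[RHS](@cat_take_permword x0 _ p k); last by rewrite size_takel; lia.
    rewrite take_takel; last by rewrite leq_addr.
    congr (_ ++ (_ ++ _)); apply: eq_permword => j; rewrite nth_take //.
    by have := ltn_ord j; rewrite /q; lia.
  have eq_d : drop (p + k) v = c ++ permword w' 1%g ++ drop (q + k) v.
    rewrite -{1}(@cat_take_permword x0 v q k) // drop_cat size_takel; last by lia.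
    case: ltnP => [//|le].
    have -> : c = [::] by rewrite /c drop_oversize // size_takel; lia.
    by rewrite (_ : (p + k - q)%N = 0%N) ?drop0 //; rewrite /q; lia.
  rewrite eq_d -eq_c; apply: alt_disjoint => //.
  by rewrite -eq_d (@cat_take_permword x0 v p k).
have sp1 : (p + k.+1 <= size v)%N by lia.
have dp1 : decr (fun j : 'I_k.+1 => nth x0 v (p + j)).
  have k1k : (k.-1 < k)%N by lia.
  (* Because of the overlap, both positions lie in the right window. *)
  have last_lt : (nth x0 v (p + k) < nth x0 v (p + k.-1))%N.
    have lt1 : (k - d.+1 < k)%N by lia.
    have lt2 : (k - d.+2 < k)%N by lia.
    have := dq (Ordinal lt2) (Ordinal lt1).
    rewrite /= (_ : p + d.+1 + (k - d.+1) = p + k)%N; last by lia.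
    by rewrite (_ : p + d.+1 + (k - d.+2) = p + k.-1)%N; last lia; apply; lia.
  move=> i j ij; have [ltj|] := ltnP j k.
    exact: (dp (Ordinal (ltn_trans ij ltj)) (Ordinal ltj)).
  move=> kj; have -> : (j : nat) = k by have := ltn_ord j; lia.
  have [->//|ni] := eqVneq (i : nat) k.-1.
  have lti : (i < k)%N by have := ltn_ord j; lia.
  apply: (ltn_trans last_lt); apply: (dp (Ordinal lti) (Ordinal k1k)) => /=; lia.
have shift : alt f (take p v) (fun j : 'I_k => nth x0 v (p + j)) (drop (p + k) v)
  = alt f (take p.+1 v) (fun j : 'I_k => nth x0 v (p.+1 + j)) (drop (p.+1 + k) v).
  have := @alt_shift f (take p v) _ (drop (p + k.+1) v) dp1.
  rewrite cat_take_permword // => /(_ f0).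
  rewrite /= addn0 -(take_nth x0); last by lia.
  rewrite addnS -(drop_nth x0); last by lia.
  move=> E; rewrite addSn.
  transitivity (alt f (take p v) ((fun j : 'I_k.+1 => nth x0 v (p + j)) \o lift ord_max)
      (drop (p + k) v)); last rewrite E.
    by apply: eq_alt => j /=; rewrite /bump leqNgt ltn_ord.
  by apply: eq_alt => j /=; rewrite /bump /= add1n addnS.
rewrite shift -addSnnS IH //; last by rewrite addSnnS.
split=> [|i j ij]; rewrite ?addSnnS //.
have si : (i.+1 < k.+1)%N by rewrite ltnS.
have sj : (j.+1 < k.+1)%N by rewrite ltnS.
exact: (dp1 (Ordinal si) (Ordinal sj)).
Qed.

Lemma alt_confluent f v a (w : 'I_k -> 'I_m) b a' (w' : 'I_k -> 'I_m) b' :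
  alt_vanishes_below f (rank v) -> decr w -> decr w' ->
  v = a ++ permword w 1%g ++ b -> v = a' ++ permword w' 1%g ++ b' ->
  alt f a w b = alt f a' w' b'.
Proof.
move=> f0 dw dw' e e'.
(* For [k = 0] there is no letter to serve as default, but the only permutation is trivial and both
   alternators are [f v]. *)
have [k0 | k_gt0] := posnP k.
  have triv a1 (w1 : 'I_k -> 'I_m) b1 : alt f a1 w1 b1 = f (a1 ++ permword w1 1%g ++ b1).
    rewrite alt_top big1 ?addr0 // => s /negP[]; apply/eqP/permP => i.
    by have: (i < 0)%N by rewrite -[X in (_ < X)%N]k0.
  by rewrite !triv -e -e'.
pose x0 := w (Ordinal k_gt0).
have pos a1 (w1 : 'I_k -> 'I_m) b1 : decr w1 -> v = a1 ++ permword w1 1%g ++ b1 ->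
  [/\ (size a1 + k <= size v)%N, decr (fun j : 'I_k => nth x0 v (size a1 + j)) &
    alt f a1 w1 b1 = alt f (take (size a1) v)
      (fun j : 'I_k => nth x0 v (size a1 + j)) (drop (size a1 + k) v)].
  move=> dw1 ->; rewrite !size_cat size_permword.
  have nthE (j : 'I_k) : nth x0 (a1 ++ permword w1 1%g ++ b1) (size a1 + j) = w1 j.
    rewrite nth_cat ltnNge leq_addr /= addKn nth_cat size_permword ltn_ord.
    by rewrite permword_nth perm1.
  split; first by rewrite leq_add2l leq_addr.
    by move=> i j ij; rewrite !nthE dw1.
  rewrite take_size_cat // addnC -drop_drop drop_size_cat // drop_size_cat ?size_permword //.
  by apply: eq_alt => j; rewrite nthE.
have [sz d ->] := pos _ _ _ dw e; have [sz' d' ->] := pos _ _ _ dw' e'.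
have [le|/ltnW le] := leqP (size a) (size a').
  exact: alt_confluent_nth.
by apply/esym/alt_confluent_nth.
Qed.

End Confluence.

(** * Normal form functionals *)

Section NormalForm.
Variables (m k : nat).
Implicit Types (a b v z : seq 'I_m).

Lemma admissiblePn v : reflect
  (exists a (w : 'I_k -> 'I_m) b, decr w /\ v = a ++ permword w 1%g ++ b)
  (~~ admissible k v).
Proof.
rewrite negbK; apply: (iffP existsP) => [[t /andP[st /infixP[a [b ->]]]]|].
  exists a, (tnth t), b; split=> [i j ij|].
    have x0 : 'I_m := tnth t i.
    rewrite !(tnth_nth x0).
    by apply: (sorted_ltn_nth (@gt_letter_trans m) x0 st); rewrite ?inE ?size_tuple.
  congr (_ ++ (_ ++ _)); rewrite -[LHS]map_tnth_enum.
  by apply/eq_map => i /=; rewrite perm1.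
move=> [a [w [b [dw ->]]]].
have sz : size (permword w 1%g) == k by rewrite size_permword.
exists (Tuple sz); rewrite (sorted_permword1 dw) /=.
by apply/infixP; exists a, b.
Qed.

Section Functionals.
Variable K : comNzRingType.

(** A non-admissible word of rank [N] is corrected by the value of an alternator it leads. By
    confluence the choice of alternator is irrelevant; its other terms have smaller rank and keep
    their values. *)
Lemma nf_approx z N : exists f : seq 'I_m -> K^o,
  alt_vanishes_below k f N /\ forall v, admissible k v -> f v = (v == z)%:R.
Proof.
elim: N => [|N [f [f0 f1]]]; first by exists (fun v => (v == z)%:R).
have /choice[g gP] v : exists x : K^o,
    (forall a (w : 'I_k -> 'I_m) b, decr w -> v = a ++ permword w 1%g ++ b ->
       rank v = N -> x = f v - alt f a w b) /\
    (rank v <> N \/ admissible k v -> x = f v).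
  have [rv|rv] := eqVneq (rank v) N; last first.
    by exists (f v); split=> // a w b _ _ /eqP; rewrite (negPf rv).
  have [adm|] := boolP (admissible k v).
    exists (f v); split=> // a w b dw e.
    have : ~~ admissible k v by apply/admissiblePn; exists a, w, b.
    by rewrite adm.
  move=> nadm; have /admissiblePn[a [w [b [dw e]]]] := nadm.
  exists (f v - alt f a w b); split=> [a' w' b' dw' e' _|[/(_ rv)[]|//]].
    by rewrite (@alt_confluent _ _ _ _ f v a' w' b' a w b) ?rv.
exists g; split=> [a w b dw|v adm]; last by rewrite (gP v).2 ?f1 //; right.
rewrite ltnS leq_eqVlt => /orP[/eqP rN|rN].
  rewrite alt_top ((gP _).1 a w b) //; set T := (X in _ + X).
  suff -> : T = \sum_(s : 'S_k | s != 1%g) (-1) ^+ s *: f (a ++ permword w s ++ b).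
    by rewrite alt_top opprD addrA subrr sub0r addNr.
  apply: eq_bigr => s s1; rewrite (gP _).2 //; left => rs.
  by have := rank_permword a b dw s1; rewrite rs rN ltnn.
rewrite -[RHS](f0 a w b dw rN); apply: eq_bigr => s _; rewrite (gP _).2 //; left => rs.
by have := rank_permword_le s a b dw; rewrite rs leqNgt rN.
Qed.

(* The functional "coefficient of the admissible word [z]" on words. *)
Lemma nf_exists : exists nf : seq 'I_m -> seq 'I_m -> K^o,
  (forall z a (w : 'I_k -> 'I_m) b, decr w -> alt (nf z) a w b = 0) /\
  (forall z v, admissible k v -> nf z v = (v == z)%:R).
Proof.
have /choice[nf nfP] (z : seq 'I_m) : exists f : seq 'I_m -> K^o,
    (forall a (w : 'I_k -> 'I_m) b, decr w -> alt f a w b = 0) /\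
    (forall v, admissible k v -> f v = (v == z)%:R).
  have [f [f0 f1]] := nf_approx z (m ^ size z).
  (* All words as long as [z] have rank below [m ^ size z], so the approximation is exact on them;
     alternators preserve length, so 0 may be used elsewhere. *)
  exists (fun v => if size v == size z then f v else 0); split=> [a w b dw|v adm].
    have szE s : size (a ++ permword w s ++ b) = (size a + (k + size b))%N.
      by rewrite !size_cat size_permword.
    have [sz|sz] := eqVneq (size a + (k + size b))%N (size z).
      rewrite -[RHS](f0 a w b dw).
        by apply: eq_bigr => s _; rewrite szE sz eqxx.
      by rewrite -sz -(szE 1%g) rank_lt.
    by apply: big1 => s _; rewrite szE (negPf sz) scaler0.
  case: eqP => [_|sz]; first exact: f1.
  by case: eqP => // vz; case: sz; rewrite vz.
by exists nf; split=> z; [apply: (nfP z).1 | apply: (nfP z).2].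
Qed.

Section Expansion.
Variables (nf : seq 'I_m -> seq 'I_m -> K^o).
Hypothesis nf_alt : forall z a (w : 'I_k -> 'I_m) b, decr w -> alt (nf z) a w b = 0.
Hypothesis nf_adm : forall z v, admissible k v -> nf z v = (v == z)%:R.

(** Both sides agree on admissible words and vanish on alternators; rewriting a leading word by
    terms of smaller rank gives the rest by induction. *)
Lemma nf_expand (V : lmodType K) (f : seq 'I_m -> V) :
  (forall a (w : 'I_k -> 'I_m) b, decr w -> alt f a w b = 0) ->
  forall v, f v = \sum_(z : (size v).-tuple 'I_m | admissible k z) nf z v *: f z.
Proof.
move=> f0 v; move: {2}(rank v).+1 (ltnSn (rank v)) => N.
have [n] : exists n, n = size v by exists (size v).
move=> sz; rewrite -sz; elim: N v sz => // N IH v sz; rewrite ltnS => rv.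
have [adm|/admissiblePn[a [w [b [dw e]]]]] := boolP (admissible k v).
  have sz' : size v == n by rewrite sz.
  rewrite (bigD1 (Tuple sz')) //= big1 => [|z /andP[_ zv]].
    by rewrite nf_adm // eqxx scale1r addr0.
  rewrite nf_adm // (_ : v == z = false) ?scale0r //.
  by apply: contraNF zv => /eqP vz; apply/eqP/val_inj.
have top (W : lmodType K) (g : seq 'I_m -> W) : alt g a w b = 0 -> g v =
    - \sum_(s : 'S_k | s != 1%g) (-1) ^+ s *: g (a ++ permword w s ++ b).
  by rewrite alt_top -e => /eqP; rewrite addr_eq0 => /eqP.
rewrite (top _ _ (f0 a w b dw)).
under [RHS]eq_bigr => z _ do rewrite (top _ _ (nf_alt z a b dw)) scaleNr scaler_suml.
rewrite sumrN exchange_big /=; congr (- _); apply: eq_bigr => s s1.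
rewrite [in LHS]IH.
- by rewrite scaler_sumr; apply: eq_bigr => z _; rewrite scalerA.
- by rewrite sz e !size_cat !size_permword.
- by apply: leq_trans rv; rewrite e rank_permword.
Qed.

(** Alternators preserve the multiset of letters, so rewriting never leaves the rearrangements of a
    word. *)
Lemma nf_perm z v : nf z v != 0 -> perm_eq v z.
Proof.
move: {2}(rank v).+1 (ltnSn (rank v)) => N; elim: N v => // N IH v; rewrite ltnS => rv.
have [adm|/admissiblePn[a [w [b [dw e]]]]] := boolP (admissible k v).
  by rewrite nf_adm //; case: (eqVneq v z) => [->//|]; rewrite eqxx.
apply: contraNT => npz; have := nf_alt z a b dw; rewrite alt_top -e => /eqP.
rewrite addr_eq0 => /eqP ->; rewrite oppr_eq0; apply/eqP/big1 => s s1.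
have rs : (rank (a ++ permword w s ++ b) < N)%N.
  by apply: leq_trans rv; rewrite e rank_permword.
have [->|/(IH _ rs)] := eqVneq (nf z (a ++ permword w s ++ b)) 0.
  by rewrite scaler0.
have /permPl -> : perm_eq (a ++ permword w s ++ b) v.
  by rewrite e perm_cat2l perm_cat2r perm_permword.
by rewrite (negPf npz).
Qed.

End Expansion.
End Functionals.
End NormalForm.

(** * Linear substitutions and their traces *)

Section Action.
Variables (m : nat) (K : comNzRingType).
Implicit Types (g h : 'M[K]_m) (a b v z : seq 'I_m).

(* The action of [g] on a function of words is the one that substitutes
   [\sum_y g x y *: y] for every letter [x]. *)
Fixpoint act (V : lmodType K) g (f : seq 'I_m -> V) v : V :=
  if v is x :: v' then \sum_y g x y *: act g (fun u => f (y :: u)) v' else f [::].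

Section ActionTheory.
Variable V : lmodType K.
Implicit Types (f : seq 'I_m -> V).

Lemma eq_act g f f' v : (forall u, size u = size v -> f u = f' u) -> act g f v = act g f' v.
Proof.
elim: v f f' => [|x v IH] f f' e /=; first exact: e.
apply: eq_bigr => y _; congr (_ *: _); apply: IH => u su; apply: e => /=.
by rewrite su.
Qed.

Lemma act_sum (I : finType) (P : pred I) (c : I -> K) (F : I -> seq 'I_m -> V) g v :
  act g (fun u => \sum_(i | P i) c i *: F i u) v = \sum_(i | P i) c i *: act g (F i) v.
Proof.
elim: v F => //= x v IH F.
under eq_bigr => y _ do rewrite IH scaler_sumr.
rewrite exchange_big /=; apply: eq_bigr => i _; rewrite scaler_sumr.
by apply: eq_bigr => y _; rewrite !scalerA mulrC.
Qed.

Lemma act_eq0 g f v : (forall u, size u = size v -> f u = 0) -> act g f v = 0.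
Proof.
move=> f0; have := act_sum (I := unit) xpred0 (fun=> 0) (fun=> f) g v.
by rewrite big_pred0_eq => <-; apply: eq_act => u su; rewrite f0 // big_pred0_eq.
Qed.

Lemma act_cat g f a v :
  act g f (a ++ v) = act g (fun i => act g (fun j => f (i ++ j)) v) a.
Proof. by elim: a f => //= x a IH f; apply: eq_bigr => y _; rewrite IH. Qed.

Lemma act_mul g h f v : act g (act h f) v = act (g *m h) f v.
Proof.
elim: v f => //= x v IH f.
under eq_bigr => y _ do rewrite act_sum scaler_sumr.
rewrite exchange_big /=; apply: eq_bigr => z _.
rewrite mxE scaler_suml; apply: eq_bigr => y _.
by rewrite scalerA IH.
Qed.

Lemma act_permword g f k (u : 'I_k -> 'I_m) : act g f (permword u 1%g) =
  \sum_(y : {ffun 'I_k -> 'I_m}) (\prod_l g (u l) (y l)) *: f (permword y 1%g).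
Proof.
elim: k f u => [|k IH] f u.
  have perm0 (w : 'I_0 -> 'I_m) : permword w 1%g = [::].
    by apply: size0nil; rewrite size_permword.
  rewrite perm0 /=.
  rewrite (bigD1 (finfun (widen_ord (leq0n m)) : {ffun 'I_0 -> 'I_m})) //=.
  rewrite [X in _ + X]big1 => [|y /negP[]]; last first.
    by apply/eqP/ffunP; case.
  by rewrite big_ord0 scale1r addr0 perm0.
have permS (w : 'I_k.+1 -> 'I_m) : permword w 1%g = w ord0 :: permword (w \o lift ord0) 1%g.
  by rewrite -permword_lift0 lift_perm1.
pose F (p : 'I_m * {ffun 'I_k -> 'I_m}) : {ffun 'I_k.+1 -> 'I_m} :=
  [ffun j => if unlift ord0 j is Some i then p.2 i else p.1].
rewrite [RHS](reindex F) /=; last first.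
  exists (fun y => (y ord0, [ffun i => y (lift ord0 i)])) => [[x y] _ | y _].
    rewrite /F !ffunE unlift_none /=; congr (_, _); apply/ffunP => i.
    by rewrite !ffunE liftK.
  by apply/ffunP => j; rewrite !ffunE; case: unliftP => [i|] -> /=; rewrite ?ffunE.
rewrite permS /= -(pair_bigA _ (fun x y => (\prod_l g (u l) (F (x, y) l)) *:
  f (permword (F (x, y)) 1%g))) /=.
apply: eq_bigr => x _; rewrite IH scaler_sumr; apply: eq_bigr => y _.
rewrite scalerA big_ord_recl permS; congr (_ * _ *: f (_ :: _)).
- by rewrite ffunE unlift_none.
- by apply: eq_bigr => l _; rewrite ffunE liftK.
- by rewrite ffunE unlift_none.
- by apply: eq_permword => l /=; rewrite ffunE liftK.
Qed.

(** * Alternators are preserved by linear substitutions *)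

Section Equivariance.
Variables (k : nat) (f : seq 'I_m -> V).
Hypothesis f_alt : forall a (w : 'I_k -> 'I_m) b, decr w -> alt f a w b = 0.

(** The transposition of two equal letters pairs even with odd permutations and the terms cancel in
    pairs, in any characteristic. *)
Lemma alt_not_inj a (u : 'I_k -> 'I_m) b : ~ injective u -> alt f a u b = 0.
Proof.
move=> ninj; have [i [j [nij uij]]] : exists i j, i != j /\ u i = u j.
  apply: contrapT => H; apply: ninj => i j e; apply/eqP; apply: contrapT => /negP nij.
  by apply: H; exists i, j.
rewrite /alt (bigID (@odd_perm _)) /=.
rewrite (reindex_inj (mulIg (tperm i j))) /= addrC.
rewrite [X in _ + X](eq_bigl (fun s : 'S_k => ~~ odd_perm s)); last first.
  by move=> s; rewrite odd_permM odd_tperm nij addbT.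
rewrite -big_split /=; apply: big1 => s es.
rewrite odd_permM odd_tperm nij (negPf es) /= expr0 expr1 scale1r scaleN1r.
rewrite -permword_comp.
rewrite (@eq_permword _ _ (u \o tperm i j) u) ?subrr // => l /=.
by case: tpermP => [->|->|//].
Qed.

(** Sorting distinct letters into decreasing order costs only a sign. *)
Lemma alt_all a (u : 'I_k -> 'I_m) b : alt f a u b = 0.
Proof.
have [iu|] := pselect (injective u); last exact: alt_not_inj.
pose le (x y : 'I_m) := (y <= x)%N.
pose t := [tuple u i | i < k].
have sz : size (sort le t) == k by rewrite size_sort size_tuple.
pose T := Tuple sz.
have /tuple_permP[p Tp] : perm_eq T t by rewrite /= perm_sort.
have TE i : tnth T i = u (p i).
  have -> : T = [tuple tnth t (p i) | i < k] by apply: val_inj.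
  by rewrite !tnth_mktuple.
have : alt f a (u \o p) b = 0.
  apply: f_alt => i j ij /=.
  have : (u (p j) <= u (p i))%N.
    have le_trans : transitive le.
      by move=> y x z /= xy yz; apply: leq_trans yz xy.
    have le_refl : reflexive le by move=> x; apply: leqnn.
    have le_total : total le by move=> x y; apply: leq_total.
    rewrite -!TE !(tnth_nth (u i)).
    by apply: (sorted_leq_nth le_trans le_refl (u i) (sort_sorted le_total t));
      rewrite ?inE ?(eqP sz) // ltnW.
  rewrite leq_eqVlt => /orP[/eqP/val_inj/iu/perm_inj ji|//].
  by rewrite ji ltnn in ij.
rewrite alt_comp => /(congr1 (fun x => (-1) ^+ p *: x)).
by rewrite scalerA -expr2 sqrr_sign scale1r scaler0.
Qed.

(** After expansion, permuting the letters of [u] permutes the chosen letters [y] with the same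
    coefficient [c y]. This leaves a combination of alternators of arbitrary words [y], whence the
    need for [alt_all]. *)
Lemma act_alt h a (u : 'I_k -> 'I_m) b : alt (act h f) a u b = 0.
Proof.
rewrite /alt; under eq_bigr => s _ do rewrite act_cat.
rewrite -act_sum; apply: act_eq0 => i _.
under eq_bigr => s _ do rewrite act_cat.
pose c (y : 'I_k -> 'I_m) := \prod_l h (u l) (y l).
have actE (s : 'S_k) : act h (fun p => act h (fun j => f (i ++ p ++ j)) b) (permword u s) =
  \sum_(y : {ffun 'I_k -> 'I_m}) c y *: act h (fun j => f (i ++ permword y s ++ j)) b.
  rewrite -[s in LHS]mul1g -permword_comp act_permword.
  pose F (y : {ffun 'I_k -> 'I_m}) : {ffun 'I_k -> 'I_m} := [ffun l => y (s l)].
  rewrite (reindex F) /=; last first.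
    exists (fun y => [ffun l => y (s^-1%g l)]) => y _; apply/ffunP => l;
      by rewrite !ffunE ?permK ?permKV.
  apply: eq_bigr => y _; rewrite /c; congr (_ *: _).
    by rewrite [RHS](reindex_inj (@perm_inj _ s)) /=; apply: eq_bigr => l _; rewrite ffunE.
  apply: eq_act => j _; rewrite -[s in RHS]mul1g -permword_comp.
  by rewrite (@eq_permword _ _ (F y) (y \o s)) // => l; rewrite ffunE.
under eq_bigr => s _ do rewrite actE scaler_sumr.
rewrite exchange_big /= big1 // => y _.
under eq_bigr => s _ do rewrite scalerA mulrC -scalerA.
rewrite -scaler_sumr -act_sum act_eq0 ?scaler0 // => j _.
exact: alt_all.
Qed.

End Equivariance.

(** * Triangular substitutions *)

Section Triangular.
Variable g : 'M[K]_m.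
Hypothesis g_trig : is_trig_mx g.

(** A lower triangular [g] replaces letters by letters no larger, so this sum never grows, and it is
    kept only when every letter is replaced by itself. *)
Definition letter_sum v : nat := sumn [seq val x | x <- v].

Lemma act_trig0 f v : (forall u, (letter_sum u <= letter_sum v)%N -> f u = 0) ->
  act g f v = 0.
Proof.
elim: v f => [|x v IH] f f0 /=; first exact: f0.
apply: big1 => y _; have [xy|yx] := ltnP x y.
  by rewrite (is_trig_mxP g_trig) ?scale0r.
by rewrite IH ?scaler0 // => u su; apply: f0; rewrite /letter_sum /= leq_add.
Qed.

Lemma act_trig f v : (forall u, (letter_sum u < letter_sum v)%N -> f u = 0) ->
  act g f v = (\prod_(x <- v) g x x) *: f v.
Proof.
elim: v f => [|x v IH] f f0 /=; first by rewrite big_nil scale1r.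
rewrite (bigD1 x) //= big1 => [|y yx]; last first.
  have [xy|xy] := ltnP x y; first by rewrite (is_trig_mxP g_trig) ?scale0r.
  rewrite act_trig0 ?scaler0 // => u su; apply: f0; rewrite /letter_sum /=.
  by rewrite -addSn leq_add // ltn_neqAle yx xy.
rewrite addr0 IH ?big_cons ?scalerA // => u su; apply: f0.
by rewrite /letter_sum /= ltn_add2l.
Qed.

End Triangular.
End ActionTheory.

Lemma act_linear (V W : lmodType K) (L : {linear V -> W}) g (f : seq 'I_m -> V) v :
  L (act g f v) = act g (fun u => L (f u)) v.
Proof.
elim: v f => //= x v IH f; rewrite linear_sum; apply: eq_bigr => y _.
by rewrite linearZ /= IH.
Qed.

Section Trace.
Variables (k : nat) (nf : seq 'I_m -> seq 'I_m -> K^o).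
Hypothesis nf_alt : forall z a (w : 'I_k -> 'I_m) b, decr w -> alt (nf z) a w b = 0.
Hypothesis nf_adm : forall z v, admissible k v -> nf z v = (v == z)%:R.

(* The trace of the action of [g] on the degree [n] component of the algebra. *)
Definition word_trace n g : K := \sum_(z : n.-tuple 'I_m | admissible k z) act g (nf z) z.

(** Since [act h (nf z)] again vanishes on alternators, it expands in the functionals [nf u], and
    substitutions compose like matrices indexed by admissible words. *)
Lemma act_nf_mul g h n (z v : n.-tuple 'I_m) : act (g *m h) (nf z) v =
  \sum_(u : n.-tuple 'I_m | admissible k u) act h (nf z) u * act g (nf u) v.
Proof.
rewrite -act_mul (@eq_act _ g _ (fun v => \sum_(u : n.-tuple 'I_m | admissible k u)
  act h (nf z) u *: nf u v)) ?act_sum // => u; rewrite size_tuple => su.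
have := nf_expand nf_alt nf_adm (fun a w b _ => act_alt (@nf_alt z) h a w b) u.
rewrite su => ->; apply: eq_bigr => y _.
exact: mulrC.
Qed.

Lemma word_traceC n g h : word_trace n (g *m h) = word_trace n (h *m g).
Proof.
rewrite /word_trace; under eq_bigr => z _ do rewrite act_nf_mul.
under [RHS]eq_bigr => z _ do rewrite act_nf_mul.
rewrite exchange_big /=; apply: eq_bigr => z _; apply: eq_bigr => u _.
exact: mulrC.
Qed.

(** [nf z] is supported on rearrangements of [z], which all have the same letter sum, so only the
    diagonal product survives. *)
Lemma word_trace_trig n g : is_trig_mx g -> word_trace n g =
  \sum_(z : n.-tuple 'I_m | admissible k z) \prod_(x <- z) g x x.
Proof.
move=> tg; apply: eq_bigr => z adm; rewrite act_trig // => [|u su].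
  by rewrite nf_adm // eqxx; apply: mulr1.
apply/eqP; apply: contraTT su => /(nf_perm nf_alt nf_adm) p.
rewrite /letter_sum (perm_sumn (perm_map val p)) ltnn //.
Qed.

End Trace.
End Action.

(** * The algebra and its basis of admissible monomials *)

Section LinearExtension.
Variables (I : choiceType) (K : comNzRingType) (V : lmodType K) (f : I -> V).

Definition malg_ext (p : malg I K) : V := \sum_(i <- monalg.msupp p) monalg.mcoeff i p *: f i.

Lemma malg_extEw (d : {fset I}) p :
  fsubset (monalg.msupp p) d -> malg_ext p = \sum_(i <- d) monalg.mcoeff i p *: f i.
Proof.
move=> le; apply: big_fset_incl => // i _ /monalg.mcoeff_outdom ->.
by rewrite scale0r.
Qed.

Lemma malg_ext_is_linear : linear malg_ext.
Proof.
move=> c p q; pose d := fsetU (monalg.msupp (c *: p + q)) (fsetU (monalg.msupp p) (monalg.msupp q)).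
rewrite !(@malg_extEw d) ?fsubsetUl //; last first.
- by rewrite /d fsetUCA fsubsetUl.
- by rewrite /d fsetUA fsubsetUr.
rewrite scaler_sumr -big_split /=; apply: eq_bigr => i _.
by rewrite monalg.mcoeffD monalg.mcoeffZ scalerDl scalerA.
Qed.

HB.instance Definition _ := GRing.isLinear.Build K (malg I K) V *:%R malg_ext malg_ext_is_linear.

Lemma malg_extU c i : malg_ext (mkmalgU i c) = c *: f i.
Proof.
rewrite (@malg_extEw [fset i]%fset) ?monalg.msuppU_le // big_seq_fset1.
by rewrite monalg.mcoeffUU.
Qed.

End LinearExtension.

Section AlgebraB.
Variables (K : comNzRingType) (m k : nat).
Implicit Types (a b v z : seq 'I_m).
Local Notation B := (algB K m k).
Local Notation pi := (quotpi (@relB K m k)).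

Definition free_mon v : freealg K m := \prod_(i <- v) fvar K i.

Lemma free_monE v : free_mon v = mkmalgU (FMonom v) 1.
Proof.
rewrite /free_mon; elim: v => [|x v IH].
  by rewrite big_nil -[FMonom [::]]fmoneE.
rewrite big_cons IH [LHS]malgM_def fgmulUU mul1r; congr (mkmalgU _ _).
by apply/val_inj; rewrite /= fmM fmU.
Qed.

Lemma free_mon_cat a b : free_mon (a ++ b) = free_mon a * free_mon b.
Proof. exact: big_cat. Qed.

Lemma free_mon_span (p : freealg K m) :
  p = \sum_(w <- monalg.msupp p) monalg.mcoeff w p *: free_mon w.
Proof.
rewrite {1}[p]monalgE; apply: eq_bigr => w _; rewrite free_monE fmK.
apply/monalg.malgP => j; rewrite monalg.mcoeffZ !monalg.mcoeffU.
by case: eqP => _; rewrite ?mulr1 ?mulr0.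
Qed.

Lemma free_mon_lin0 (V : lmodType K) (L : freealg K m -> V) :
  linear L -> (forall v, L (free_mon v) = 0) -> forall p, L p = 0.
Proof.
move=> linL L0 p; rewrite [p]free_mon_span.
have LD x y : L (x + y) = L x + L y by rewrite -[x]scale1r linL !scale1r.
have L00 : L 0 = 0 by apply: (addrI (L 0)); rewrite -LD !addr0.
rewrite (big_morph L LD L00); apply: big1 => w _.
by rewrite -[_ *: _]addr0 linL L0 L00 scaler0 addr0.
Qed.

Lemma alternatorE (u : 'I_k -> 'I_m) :
  alternator K u = \sum_(s : 'S_k) (-1) ^+ s *: free_mon (permword u s).
Proof.
apply: eq_bigr => s _; by congr (_ *: _); rewrite [RHS]big_map enumT [index_enum _]unlock.
Qed.

Lemma alt_free_mon a (u : 'I_k -> 'I_m) b :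
  alt free_mon a u b = free_mon a * alternator K u * free_mon b.
Proof.
rewrite alternatorE mulr_sumr mulr_suml; apply: eq_bigr => s _.
by rewrite !free_mon_cat mulrA -scalerAr -scalerAl.
Qed.

Lemma linear_alt (V W : lmodType K) (L : {linear V -> W}) (f : seq 'I_m -> V)
  a (u : 'I_k -> 'I_m) b : L (alt f a u b) = alt (fun v => L (f v)) a u b.
Proof. by rewrite linear_sum; apply: eq_bigr => s _; rewrite linearZ. Qed.

Lemma monB_gen v : monB (@genB K m k) v = pi (free_mon v).
Proof. by rewrite /free_mon rmorph_prod. Qed.

(** The defining relations have increasing indices; the reversal [r] makes [w] increasing and
    changes the alternator by a sign. *)
Lemma alt_monB a (w : 'I_k -> 'I_m) b : decr w -> alt (monB (@genB K m k)) a w b = 0.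
Proof.
move=> dw; pose r : 'S_k := perm rev_ord_inj.
have H : alt (monB (@genB K m k)) a (w \o r) b = 0.
  rewrite /alt; under eq_bigr => s _ do rewrite monB_gen.
  rewrite -/(alt (fun v => pi (free_mon v)) a (w \o r) b) -linear_alt alt_free_mon.
  rewrite -(raddf0 pi); apply/quotpi_eqP; rewrite subr0; constructor.
  exists (w \o r) => // i j ij; apply: dw; rewrite !permE /=.
  by have := ltn_ord j; lia.
move: H; rewrite alt_comp => /(congr1 (fun x => (-1) ^+ r *: x)).
by rewrite scalerA -expr2 sqrr_sign scale1r scaler0.
Qed.

Definition word_ext (V : lmodType K) (f : seq 'I_m -> V) (p : freealg K m) : V :=
  malg_ext (fun w : fmonom 'I_m => f w) p.

Lemma word_ext_is_linear (V : lmodType K) (f : seq 'I_m -> V) : linear (word_ext f).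
Proof. exact: malg_ext_is_linear. Qed.

HB.instance Definition _ (V : lmodType K) (f : seq 'I_m -> V) :=
  GRing.isLinear.Build K (freealg K m) V *:%R (@word_ext V f) (@word_ext_is_linear V f).

Lemma word_ext_mon (V : lmodType K) (f : seq 'I_m -> V) v : word_ext f (free_mon v) = f v.
Proof. by rewrite free_monE /word_ext malg_extU scale1r. Qed.

(** By linearity in each cofactor of a relation, monomial cofactors suffice, and then the element is
    an alternator of words. Thus [f] descends to the quotient. *)
Lemma word_ext_ideal (V : lmodType K) (f : seq 'I_m -> V) p :
  (forall a (w : 'I_k -> 'I_m) b, decr w -> alt f a w b = 0) ->
  two_sided_ideal (@relB K m k) p -> word_ext f p = 0.
Proof.
move=> f0; elim=> [|q r _ Iq _ Ir|a r b [u _ ->]].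
- exact: linear0.
- by rewrite linearD /= Iq Ir addr0.
move: a; apply: (free_mon_lin0 (L := fun x => word_ext f (x * alternator K u * b))).
  by move=> c x y; rewrite !mulrDl -!scalerAl linearP.
move=> i; move: b.
apply: (free_mon_lin0 (L := fun x => word_ext f (free_mon i * alternator K u * x))).
  by move=> c x y; rewrite mulrDr -scalerAr linearP.
move=> j; rewrite -alt_free_mon linear_alt /=.
rewrite -[RHS](alt_all f0 i u j); apply: eq_bigr => s _.
by rewrite word_ext_mon.
Qed.

(** * Dual functionals and the basis theorem *)

Section Basis.
Variables (nf : seq 'I_m -> seq 'I_m -> K^o).
Hypothesis nf_alt : forall z a (w : 'I_k -> 'I_m) b, decr w -> alt (nf z) a w b = 0.
Hypothesis nf_adm : forall z v, admissible k v -> nf z v = (v == z)%:R.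

(** The functional [nf z] factors through the quotient and isolates the coefficient of [z]; this
    yields independence as well as the value of [coeffG]. *)
Lemma lincomb_coeff c p z : supported_on (admissible k) c ->
  lincomb (monB (@genB K m k)) c = pi p -> admissible k z -> c z = word_ext (nf z) p.
Proof.
move=> sc; have -> : lincomb (monB (@genB K m k)) c =
    pi (\sum_(i <- finsupp c) c i *: free_mon i).
  by rewrite linear_sum; apply: eq_bigr => i _; rewrite linearZ /= monB_gen.
move/quotpi_eqP/(word_ext_ideal (@nf_alt z)); rewrite linearB => /eqP.
rewrite subr_eq0 => /eqP <- admz; rewrite linear_sum /=.
under eq_big_seq => i ic do
  rewrite linearZ /= word_ext_mon nf_adm ?[admissible _ _]sc //.
have [zc|zc] := boolP (z \in finsupp c).
  rewrite (big_rem z) //= eqxx big1_seq ?addr0 => [|i /= ic].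
    by apply/esym/mulr1.
  rewrite (_ : i == z = false) ?scaler0 //.
  by apply: contraTF ic => /eqP ->; rewrite mem_rem_uniqF // fset_uniq.
rewrite fsfun_dflt // big1_seq // => i /= ic.
by rewrite (_ : i == z = false) ?scaler0 //; apply: contraTF ic => /eqP ->.
Qed.

Lemma admissible_basis : is_basis_on (admissible k) (monB (@genB K m k)).
Proof.
split=> [c sc c0 z|v].
  have [admz|nadm] := boolP (admissible k z); last first.
    by rewrite fsfun_dflt //; apply: contraNN nadm => /sc.
  by rewrite (lincomb_coeff (p := 0) sc) ?linear0 // c0.
(* Formal combinations of words form a module and carry finitely supported coefficient functions, so
   spanning is closed under linear combinations. *)
pose E (q : malg (seq 'I_m) K) : B := malg_ext (monB (@genB K m k)) q.
suff [q sq ->] : exists2 q, {subset monalg.msupp q <= admissible k} & v = E q.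
  by exists (malg_val q).
have spanD c q1 q2 : {subset monalg.msupp q1 <= admissible k} ->
    {subset monalg.msupp q2 <= admissible k} ->
    {subset monalg.msupp (c *: q1 + q2) <= admissible k}.
  move=> s1 s2 z /(fsubsetP (monalg.msuppD_le _ _)); rewrite in_fsetU => /orP[|/s2 //].
  by move/(fsubsetP (monalg.msuppZ_le _ _))/s1.
have span_sum (J : eqType) (r : seq J) (P : pred J) (c : J -> K) (x : J -> B) :
    (forall i, P i -> exists2 q, {subset monalg.msupp q <= admissible k} & x i = E q) ->
    exists2 q, {subset monalg.msupp q <= admissible k} & \sum_(i <- r | P i) c i *: x i = E q.
  move=> xP; elim/big_rec: _ => [|i y Pi [q sq ->]].
    by exists 0; [rewrite monalg.msupp0 | rewrite /E linear0].
  have [q' sq' ->] := xP i Pi; exists (c i *: q' + q); first exact: spanD.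
  by rewrite /E linearP.
rewrite -[v]quotpi_repr [repr v]free_mon_span linear_sum /=.
under eq_bigr => w _ do rewrite linearZ /= -monB_gen.
apply: (@span_sum _ _ _ (fun w => monalg.mcoeff w (repr v))) => w _.
rewrite (nf_expand nf_alt nf_adm alt_monB); apply: span_sum => z admz.
exists (mkmalgU (val z) 1); last by rewrite /E malg_extU scale1r.
by move=> y /(fsubsetP monalg.msuppU_le); rewrite in_fset1 => /eqP ->.
Qed.

Lemma monB_lin (A : 'M[K]_m) v : monB (linB k A) v = act A (monB (@genB K m k)) v.
Proof.
elim: v => [|x v IH] /=; first by rewrite /monB !big_nil.
rewrite [LHS]big_cons [X in _ * X]IH mulr_suml.
apply: eq_bigr => y _; rewrite -algquot_scalerAl; congr (_ *: _).
have Ml (f : seq 'I_m -> B) (c : B) u : c * act A f u = act A (fun w => c * f w) u.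
  elim: u f => //= y' u IHu f; rewrite mulr_sumr; apply: eq_bigr => y'' _.
  by rewrite -algquot_scalerAr IHu.
by rewrite Ml; apply: eq_act => u _; rewrite [RHS]big_cons.
Qed.

Lemma coeffGE (A : 'M[K]_m) z : admissible k z -> coeffG k A z = act A (nf z) z.
Proof.
move=> admz; rewrite /coeffG /basis_coeff; set P := [set _ | _]%classic.
(* Spanning ensures that the chosen coefficients do represent the vector. *)
have [|sc e] := @xgetPex _ [fsfun] P.
  by have [c sc e] := admissible_basis.2 (monB (linB k A) z); exists c.
rewrite (lincomb_coeff (p := act A free_mon z) sc) //; last first.
  rewrite -e monB_lin act_linear; apply: eq_act => u _; exact: monB_gen.
by rewrite act_linear /=; apply: (@eq_act _ _ K^o) => u _; rewrite word_ext_mon.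
Qed.

End Basis.
End AlgebraB.

(** * Decreasing prefixes and admissible suffixes *)

Section Runs.
Variables (m k : nat).
Hypothesis k_gt1 : (1 < k)%N.
Implicit Types (u v : seq 'I_m).

(** The length of the longest decreasing prefix, positive on nonempty words. *)
Fixpoint decr_prefix v : nat :=
  if v is x :: v' then
    (if (if v' is y :: _ then gt_letter x y else false) then decr_prefix v' else 0%N).+1
  else 0%N.

Lemma decr_prefix_le v : (decr_prefix v <= size v)%N.
Proof.
elim: v => //= x v IH; rewrite ltnS.
by case: ifP.
Qed.

Lemma sorted_take v r : (r <= size v)%N ->
  sorted (@gt_letter m) (take r v) = (r <= decr_prefix v)%N.
Proof.
elim: v r => [|x [|y v] IH] [|[|r]] // le.
have -> : sorted (@gt_letter m) (take r.+2 [:: x, y & v]) =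
  gt_letter x y && sorted (@gt_letter m) (take r.+1 (y :: v)) by [].
rewrite IH // [decr_prefix (x :: _)]/=; case: ifP => xy /=; by rewrite ?xy ?ltnS.
Qed.

Lemma admissible_cons x v :
  admissible k (x :: v) = (decr_prefix (x :: v) < k)%N && admissible k v.
Proof.
rewrite /admissible [(decr_prefix _ < k)%N]ltnNge -negb_or; congr (~~ _).
apply/existsP/orP.
  move=> [t /andP[st]]; rewrite infix_consl => /orP[pt|it]; last first.
    by right; apply/existsP; exists t; rewrite st.
  have [u e] := prefixP pt; left; rewrite -sorted_take; last first.
    by rewrite e size_cat size_tuple leq_addr.
  by rewrite e take_size_cat ?size_tuple.
case=> [kr|/existsP[t /andP[st it]]]; last first.
  by exists t; rewrite st infix_consl it orbT.
have sz : (k <= size (x :: v))%N := leq_trans kr (decr_prefix_le _).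
have szt : size (take k (x :: v)) == k by rewrite size_takel.
exists (Tuple szt); apply/andP; split; first by rewrite [sorted _ _](sorted_take sz).
by apply/infixP; exists [::], (drop k (x :: v)); rewrite cat0s [RHS]cat_take_drop.
Qed.

Lemma admissible_nil : admissible k ([::] : seq 'I_m).
Proof.
apply/existsP => -[t /andP[_]]; rewrite infixs0 => /eqP t0.
by have := size_tuple t; rewrite t0 /=; move: k_gt1 => /[swap] <-.
Qed.

(** A decreasing factor that starts in the first run ends inside it, so only the rest of that run
    and the word after it matter. *)
Lemma admissible_drop v r : (r <= decr_prefix v)%N ->
  admissible k (drop r v) = (decr_prefix v - r < k)%N && admissible k (drop (decr_prefix v) v).
Proof.
have k_gt0 : (0 < k)%N := ltnW k_gt1.
elim: v r => [|x v IH] r; first by rewrite /= sub0n k_gt0 admissible_nil.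
case: r => [_|r]; last first.
  rewrite [drop r.+1 _]/= [decr_prefix _]/= subSS; case: ifP => xv; first exact: IH.
  by rewrite ltnS leqn0 => /eqP -> /=; rewrite drop0 k_gt0.
rewrite drop0 admissible_cons subn0 [decr_prefix _]/=; case: ifP => xv /=; last by rewrite drop0.
have := IH 0%N (leq0n _); rewrite drop0 subn0 => ->.
by case: ltnP => // /ltnW ->.
Qed.

Section Signs.
Variable K : comNzRingType.

(** This is $(-1)^{\alpha(r)+r}$ for $r\equiv 0,1$ and 0 otherwise; the extra $(-1)^r$ is the sign
    between $c_r$ and the elementary symmetric function of the eigenvalues. *)
Definition eps (r : nat) : K := (r %% k == 0)%N%:R - (r %% k == 1)%N%:R.

(** The sum telescopes: [eps r] is the indicator of $k\mid r$ minus, for $r>0$, that of $k\mid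
    r-1$. *)
Lemma sum_eps n : \sum_(r < n.+1) eps r = (n %% k == 0)%N%:R.
Proof.
elim: n => [|n IH].
  by rewrite big_ord_recl big_ord0 /eps mod0n /= addr0 subr0.
rewrite big_ord_recr /= IH /eps modnS; case: ifP => dv /=; last first.
  by rewrite eqSS sub0r subrr.
have -> : (n %% k == 0)%N = false.
  apply: contraTF dv => /eqP n0.
  by rewrite /dvdn -addn1 -modnDml n0 modn_small.
by rewrite add0r subr0.
Qed.

(** For $n\ge k$ this is the difference of the partial sums at $n$ and $n-k$, which agree; for
    $0<n<k$ it is a full partial sum, and $k\nmid n$. *)
Lemma sum_eps_window n : (0 < n)%N ->
  \sum_(r < n.+1) eps r * (n - r < k)%N%:R = 0.
Proof.
move=> n_gt0; have [nk|kn] := ltnP n k.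
  rewrite -[RHS](_ : (n %% k == 0)%N%:R = 0); last by rewrite modn_small // gtn_eqF.
  rewrite -sum_eps; apply: eq_bigr => r _.
  by rewrite (leq_ltn_trans (leq_subr _ _) nk) mulr1.
have -> : \sum_(r < n.+1) eps r * (n - r < k)%N%:R =
    \sum_(r < n.+1) eps r - \sum_(r < (n - k).+1) eps r.
  rewrite [X in _ - X](big_ord_widen n.+1 eps) ?ltnS ?leq_subr //.
  rewrite [X in _ - X]big_mkcond -sumrB; apply: eq_bigr => r _.
  have rn : (r <= n)%N by rewrite -ltnS.
  case: (ltnP r (n - k).+1) => lt; case: ltnP => lt'; rewrite ?mulr1 ?mulr0 ?subrr ?subr0 //; lia.
rewrite !sum_eps (_ : (n %% k = (n - k) %% k)%N) ?subrr //.
by rewrite -{1}(subnK kn) modnDr.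
Qed.

(* Splitting a word into a decreasing prefix and an admissible suffix: the
   lengths of the prefix range over a window of [k] consecutive integers. *)
Lemma sum_eps_split v : \sum_(r < (size v).+1)
    eps r * (sorted (@gt_letter m) (take r v) && admissible k (drop r v))%:R
  = (v == [::])%:R.
Proof.
case: v => [|x v].
  rewrite big_ord_recl big_ord0 /= admissible_nil addr0 mulr1.
  by rewrite /eps mod0n /= subr0.
rewrite [RHS]/=; have : (0 < decr_prefix (x :: v))%N by [].
move: (x :: v) => {x v} w prefix_gt0.
transitivity ((\sum_(r < (decr_prefix w).+1) eps r * (decr_prefix w - r < k)%N%:R) *
  (admissible k (drop (decr_prefix w) w))%:R : K); last by rewrite sum_eps_window // mul0r.
rewrite mulr_suml.
rewrite [RHS](big_ord_widen _ (fun r => eps r * (decr_prefix w - r < k)%N%:R *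
  (admissible k (drop (decr_prefix w) w))%:R)
  (decr_prefix_le w : ((decr_prefix w).+1 <= (size w).+1)%N)).
rewrite [RHS]big_mkcond /=.
apply: eq_bigr => r _; have rw : (r <= size w)%N := ltn_ord r.
rewrite sorted_take // [(r < _.+1)%N]ltnS.
case: (leqP r (decr_prefix w)) => [le|_]; last exact: mulr0.
by rewrite andTb admissible_drop // -mulrA -natrM mulnb.
Qed.

Section WordSums.
Variable l : 'I_m -> K.

Definition wt v : K := \prod_(x <- v) l x.

Definition adm_sum n : K := \sum_(v : n.-tuple 'I_m | admissible k v) wt v.

Definition decr_sum n : K := \sum_(v : n.-tuple 'I_m | sorted (@gt_letter m) v) wt v.

Lemma sum_tupleS n (F : seq 'I_m -> K) :
  \sum_(v : n.+1.-tuple 'I_m) F v = \sum_x \sum_(v : n.-tuple 'I_m) F (x :: v).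
Proof.
rewrite pair_bigA /= (reindex (fun p : 'I_m * n.-tuple 'I_m => [tuple of p.1 :: p.2])) //=.
exists (fun t => (thead t, [tuple of behead t])) => [[x t] _ | t _] /=.
  by congr (_, _); apply: val_inj.
by rewrite -tuple_eta.
Qed.

Lemma sum_tuple_cat r s (F : seq 'I_m -> K) : \sum_(v : (r + s).-tuple 'I_m) F v =
  \sum_(u : r.-tuple 'I_m) \sum_(v : s.-tuple 'I_m) F (u ++ v).
Proof.
elim: r F => [|r IH] F.
  rewrite [RHS](bigD1 [tuple]) //= [X in _ + X]big1 ?addr0 // => u /negP[]; apply/eqP.
  exact: tuple0.
rewrite [LHS]sum_tupleS (sum_tupleS _ (fun u => \sum_(v : s.-tuple 'I_m) F (u ++ v))).
by apply: eq_bigr => x _; rewrite (IH (fun u => F (x :: u))).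
Qed.

(** A decreasing word followed by an admissible one is a word with a marked splitting; summing over
    the splittings first leaves only the empty word. *)
Lemma decr_adm_sum n :
  \sum_(r < n.+1) eps r * (decr_sum r * adm_sum (n - r)) = (n == 0)%N%:R.
Proof.
have prodE (r : 'I_n.+1) : decr_sum r * adm_sum (n - r) =
    \sum_(v : n.-tuple 'I_m)
      (sorted (@gt_letter m) (take r v) && admissible k (drop r v))%:R * wt v.
  have rn : (r + (n - r) = n)%N by rewrite subnKC // -ltnS.
  have := sum_tuple_cat r (n - r) (fun v =>
    (sorted (@gt_letter m) (take r v) && admissible k (drop r v))%:R * wt v).
  rewrite rn => ->.
  rewrite /decr_sum big_mkcond mulr_suml; apply: eq_bigr => u _.
  rewrite /adm_sum big_mkcond mulr_sumr; apply: eq_bigr => v _ /=.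
  rewrite take_size_cat ?size_tuple // drop_size_cat ?size_tuple // /wt big_cat.
  by case: (sorted _ u) => /=; case: (admissible k v); rewrite /= ?mul1r ?mul0r ?mulr0.
under eq_bigr => r _ do rewrite prodE mulr_sumr.
rewrite exchange_big /=.
have -> : (n == 0)%N%:R = \sum_(v : n.-tuple 'I_m) (val v == [::])%:R * wt v.
  case: n {prodE} => [|n].
    rewrite (bigD1 [tuple]) //= big1 ?addr0 => [|u /negP[]]; last first.
      by apply/eqP/tuple0.
    by rewrite /wt big_nil mulr1.
  by rewrite big1 // => v _; rewrite -size_eq0 size_tuple mul0r.
apply: eq_bigr => v _; rewrite -sum_eps_split size_tuple mulr_suml.
by apply: eq_bigr => r _; rewrite mulrA.
Qed.

Lemma mesym_decr_sum r : meval l (mesym m K r) = decr_sum r.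
Proof.
have rev_inv : involutive (fun v : r.-tuple 'I_m => [tuple of rev v]).
  by move=> v; apply: val_inj; rewrite /= revK.
rewrite mesym_tupleE raddf_sum (reindex_inj (inv_inj rev_inv)) /=.
apply: eq_big => v; first by rewrite /tmono map_rev rev_sorted sorted_map.
move=> _; rewrite rmorph_prod /= (perm_big v) /= ?perm_rev //.
by apply: eq_bigr => i _; apply: mevalXU.
Qed.

End WordSums.
End Signs.
End Runs.

(** * Reduction to triangular matrices *)

Section TraceIdentity.

Lemma char_poly_conj (R : comUnitRingType) n (P g : 'M[R]_n) : P \in unitmx ->
  char_poly (P *m g *m invmx P) = char_poly g.
Proof.
move=> Pu; pose Q := map_mx (@polyC R) P; pose Q' := map_mx (@polyC R) (invmx P).
have QQ' : Q *m Q' = 1%:M by rewrite -map_mxM mulmxV // map_mx1.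
have -> : char_poly (P *m g *m invmx P) = \det (Q *m char_poly_mx g *m Q').
  have QX : Q *m 'X%:M *m Q' = 'X%:M by rewrite scalar_mxC -mulmxA QQ' mulmx1.
  by congr (\det _); rewrite /char_poly_mx mulmxBr mulmxBl QX !map_mxM.
by rewrite !det_mulmx mulrAC -det_mulmx QQ' det1 mul1r.
Qed.

Variables (C : numClosedFieldType) (m k : nat).
Hypotheses (m_gt0 : (0 < m)%N) (k_gt1 : (1 < k)%N).
Variable nf : seq 'I_m -> seq 'I_m -> C^o.
Hypothesis nf_alt : forall z a (w : 'I_k -> 'I_m) b, decr w -> alt (nf z) a w b = 0.
Hypothesis nf_adm : forall z v, admissible k v -> nf z v = (v == z)%:R.

Lemma char_poly_coeff_decr_sum (g : 'M[C]_m) r : is_trig_mx g -> (r <= m)%N ->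
  (char_poly g)`_(m - r) = (-1) ^+ r * decr_sum (fun x => g x x) r.
Proof.
move=> tg rm; rewrite char_poly_trig //.
pose cs := [tuple g i i | i < m].
have -> : \prod_(i < m) ('X - (g i i)%:P) = \prod_(c <- cs) ('X - c%:P).
  by rewrite big_tuple; apply: eq_bigr => i _; rewrite tnth_mktuple.
rewrite (mroots_coeff cs (Ordinal (rm : (r < m.+1)%N))) /=.
rewrite -mesym_decr_sum; congr (_ * _); apply: meval_eq => i.
by rewrite tnth_mktuple.
Qed.

Lemma trace_identity (g : 'M[C]_m) n :
  \sum_(r < n.+1) eps k C r *
    ((if (r <= m)%N then (-1) ^+ r * (char_poly g)`_(m - r) else 0) *
     word_trace k nf (n - r) g) = (n == 0)%N%:R.
Proof.
(* [P] conjugates [g] to a lower triangular matrix, whose diagonal entries are the eigenvalues. *)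
have [P Pu tg] := Schur g m_gt0; have {}Pu := unitarymx_unit Pu.
move: tg; rewrite /similar_to conjumx // => tg.
have -> : char_poly g = char_poly (P *m g *m invmx P) by rewrite char_poly_conj.
rewrite -(decr_adm_sum k_gt1 (fun x => (P *m g *m invmx P) x x) n).
apply: eq_bigr => r _; congr (_ * (_ * _)).
  have [rm|mr] := leqP r m.
    by rewrite char_poly_coeff_decr_sum // mulrA -expr2 sqrr_sign mul1r.
  (* No decreasing word is longer than [m], which matches the default 0. *)
  by rewrite -mesym_decr_sum mesym_geqnE // meval0.
rewrite -[RHS](word_trace_trig nf_alt nf_adm) //.
by rewrite (word_traceC nf_alt nf_adm) mulmxA mulVmx // mul1mx.
Qed.

End TraceIdentity.

(** * From numerical identities to power series *)

Section PolynomialIdentities.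

Lemma base_expansion_inj n B (a b : 'I_n -> nat) :
  (forall i, a i < B)%N -> (forall i, b i < B)%N ->
  (\sum_i a i * B ^ i = \sum_i b i * B ^ i)%N -> a =1 b.
Proof.
elim: n a b => [|n IH] a b aB bB; first by move=> _ [].
have expand (c : 'I_n.+1 -> nat) :
    (\sum_i c i * B ^ i = (\sum_(i < n) c (lift ord0 i) * B ^ i) * B + c ord0)%N.
  rewrite big_ord_recl expn0 muln1 addnC big_distrl /=; congr (_ + _)%N.
  by apply: eq_bigr => i _; rewrite /bump /= expnS; lia.
have B_gt0 : (0 < B)%N by apply: leq_ltn_trans (aB ord0).
rewrite !expand => e.
have e0 : a ord0 = b ord0.
  by have := congr1 (modn^~ B) e; rewrite !modnMDl !modn_small.
have eS : (\sum_(i < n) a (lift ord0 i) * B ^ i = \sum_(i < n) b (lift ord0 i) * B ^ i)%N.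
  by apply/eqP; rewrite -(eqn_pmul2r B_gt0) -(eqn_add2r (a ord0)) {2}e0 e.
move=> i; case: (unliftP ord0 i) => [j|] -> //.
exact: (IH (fun j => a (lift ord0 j)) (fun j => b (lift ord0 j))).
Qed.

(* Kronecker's substitution ['X_i |-> z ^ (B ^ i)] keeps the monomials of [p]
   apart when [B] exceeds their degrees. *)
Lemma mpoly_eq0_meval (K : numDomainType) n (p : {mpoly K[n]}) :
  (forall v, meval v p = 0) -> p = 0.
Proof.
move=> p0; pose B := msize p; pose code (a : 'X_{1..n}) := (\sum_i a i * B ^ i)%N.
pose q := \sum_(a <- msupp p) p@_a *: 'X^(code a).
have q0 z : q.[z] = 0.
  rewrite -(p0 (fun i => z ^+ (B ^ i))) mevalE /q horner_sum; apply: eq_bigr => a _.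
  rewrite hornerZ hornerXn -prodrXr; congr (_ * _); apply: eq_bigr => i _.
  by rewrite mulnC exprM.
have {}q0 : q = 0.
  apply/eqP; apply: contraT => nq.
  (* In characteristic 0 these are [size q] distinct roots, more than the degree allows. *)
  have := @max_poly_roots _ q [seq i%:R | i <- iota 0 (size q)] nq.
  rewrite size_map size_iota ltnn; apply.
    by apply/allP => x _; apply/rootP.
  by rewrite map_inj_uniq ?iota_uniq //; apply: Num.Theory.mulrIn; rewrite oner_eq0.
apply/mpolyP => b; rewrite mcoeff0.
have [bp|/memN_msupp_eq0 //] := boolP (b \in msupp p).
have := congr1 (fun q : {poly K} => q`_(code b)) q0; rewrite coef0 /q coef_sum.
rewrite (big_rem b) //= coefZ coefXn eqxx mulr1 big1_seq ?addr0 // => a /= ab.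
have ap : a \in msupp p by apply: mem_rem ab.
rewrite coefZ coefXn; case: eqP => [e|_]; last by rewrite mulr0.
have small (c : 'X_{1..n}) : c \in msupp p -> forall i, (c i < B)%N.
  move=> cp i; apply: leq_ltn_trans (msize_mdeg_lt cp).
  by rewrite mdegE (bigD1 i) //= leq_addr.
have ba : a = b by apply/mnmP => i; rewrite (base_expansion_inj (small _ bp) (small _ ap) e).
by move: ab; rewrite ba mem_rem_uniqF // msupp_uniq.
Qed.

Variables (K : comNzRingType) (m : nat).
Implicit Types (p q : {poly {mpoly K[m]}}).

(* Homogeneity of total degree [d] when the variable of [{poly _}] counts as
   one more variable of degree 1. *)
Definition poly_homog d p := forall j,
  if (j <= d)%N then is_true (p`_j \is (d - j).-homog) else p`_j = 0.

Lemma poly_homog1 : poly_homog 0 1.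
Proof. by case=> [|j]; rewrite coef1 //=; apply: dhomog1. Qed.

Lemma poly_homogD d p q : poly_homog d p -> poly_homog d q -> poly_homog d (p + q).
Proof.
move=> hp hq j; have := hp j; have := hq j; rewrite coefD.
by case: ifP => _ => [hq' hp'|-> ->]; [apply: dhomogD | rewrite addr0].
Qed.

Lemma poly_homog_sign d (b : bool) p : poly_homog d p -> poly_homog d ((-1) ^+ b * p).
Proof.
move=> hp j; rewrite mulr_sign; have := hp j; case: b => //; rewrite coefN.
by case: ifP => _ => [hp'|->]; [rewrite rpredN | rewrite oppr0].
Qed.

Lemma poly_homogM d e p q : poly_homog d p -> poly_homog e q -> poly_homog (d + e) (p * q).
Proof.
move=> hp hq j; rewrite coefM.
have term (i : 'I_j.+1) : if (i <= d)%N && (j - i <= e)%N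
    then is_true (p`_i * q`_(j - i) \is (d + e - j).-homog) else p`_i * q`_(j - i) = 0.
  have := hp i; have := hq (j - i)%N; have ij : (i <= j)%N by rewrite -ltnS.
  case: (leqP i d) => id' /=; last by move=> _ ->; rewrite mul0r.
  case: (leqP (j - i) e) => je /=; last by move=> ->; rewrite mulr0.
  move=> h1 h2; have := dhomogM h2 h1.
  by rewrite (_ : d - i + (e - (j - i)) = d + e - j)%N //; lia.
case: leqP => je.
  apply: rpred_sum => i _; have := term i; case: ifP => // _ ->.
  exact: rpred0.
apply: big1 => i _; have := term i; case: ifP => // /andP[h1 h2].
by have ij : (i <= j)%N by [rewrite -ltnS]; lia.
Qed.

Lemma TA_E (A : 'M[K]_m) i j : TA A i j = 'X_i * (A i j)%:MP.
Proof. by rewrite /TA mul_diag_mx !mxE. Qed.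

(** Every entry of $\lambda I-TA$ is homogeneous of degree 1 in $\lambda$ and the $t_i$ together,
    and each Leibniz term multiplies [m] entries. *)
Lemma char_poly_TA_homog (A : 'M[K]_m) : poly_homog m (char_poly (TA A)).
Proof.
rewrite /char_poly /determinant.
elim/big_rec: _ => [|s p _ hp].
  by move=> j; rewrite coef0; case: ifP => // _; apply: dhomog0.
apply: poly_homogD hp; apply: poly_homog_sign.
suff H (r : seq 'I_m) : poly_homog (size r) (\prod_(i <- r) char_poly_mx (TA A) i (s i)).
  have := H (index_enum 'I_m).
  by rewrite {1}[index_enum _]unlock -enumT size_enum_ord.
elim: r => [|i r IH]; first by rewrite big_nil; apply: poly_homog1.
rewrite big_cons /= -add1n; apply: poly_homogM IH => j.
have -> : char_poly_mx (TA A) i (s i) = 'X *+ (i == s i) - (TA A i (s i))%:P.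
  by rewrite /char_poly_mx mxE [X in X + _]mxE [X in _ + X]mxE [X in - X]mxE.
rewrite coefB coefMn coefX coefC TA_E.
case: j => [|[|j]] /=; rewrite ?mul0rn ?sub0r ?subr0 //.
  by rewrite rpredN mulrC mul_mpolyC dhomogZ // dhomogX /= mdeg1.
  by case: (_ == _); rewrite ?mulr1n ?mulr0n; [apply: dhomog1 | apply: dhomog0].
exact: oppr0.
Qed.

Lemma cTA_homog (A : 'M[K]_m) r : (r <= m)%N -> cTA A r \is r.-homog.
Proof.
by move=> rm; have := char_poly_TA_homog A (m - r)%N; rewrite leq_subr subKn.
Qed.

Lemma meval_cTA (A : 'M[K]_m) r (v : 'I_m -> K) :
  meval v (cTA A r) = (char_poly (diag_mx (\row_i v i) *m A))`_(m - r).
Proof.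
rewrite /cTA -coef_map map_char_poly; congr (char_poly _)`_(_).
apply/matrixP => i j; rewrite mxE TA_E mul_diag_mx !mxE.
by rewrite [LHS]mevalM mevalXU mevalC.
Qed.

Lemma meval_word_monomial (s : seq 'I_m) (v : 'I_m -> K) :
  meval v (word_monomial K s) = \prod_(x <- s) v x.
Proof. by rewrite rmorph_prod; apply: eq_bigr => i _; apply: mevalXU. Qed.

(** This turns $G(\mathbf i)\,t_{i_1}\cdots t_{i_\ell}$ into a diagonal entry of the action of
    $TA$. *)
Lemma act_diag (V : lmodType K) (v : 'I_m -> K) (A : 'M[K]_m) (f : seq 'I_m -> V) s :
  act (diag_mx (\row_i v i) *m A) f s = (\prod_(x <- s) v x) *: act A f s.
Proof.
elim: s f => [|x s IH] f /=; first by rewrite big_nil scale1r.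
rewrite big_cons scaler_sumr; apply: eq_bigr => y _.
by rewrite IH mul_diag_mx !mxE !scalerA mulrAC.
Qed.

End PolynomialIdentities.

(** * From homogeneous parts to the power series identity *)

Section MasterTheorem.
Variables (C : numClosedFieldType) (m k : nat) (A : 'M[C]_m).
Hypotheses (m_gt0 : (0 < m)%N) (k_gt1 : (1 < k)%N).

Definition word_poly d : {mpoly C[m]} :=
  \sum_(s : d.-tuple 'I_m | admissible k s) coeffG k A s *: word_monomial C s.

(** The degree [r] part of the second factor, extended by 0 beyond [m] so that convolutions may run
    over all degrees. *)
Definition koszul_poly r : {mpoly C[m]} :=
  if (r <= m)%N then (eps k C r * (-1) ^+ r) *: cTA A r else 0.

Lemma koszul_poly_homog r : koszul_poly r \is r.-homog.
Proof.
rewrite /koszul_poly; case: leqP => rm; last exact: rpred0.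
by apply: rpredZ; apply: cTA_homog.
Qed.

(** At each numerical value [v] of the variables this is the trace identity for the matrix
    [diag_mx (\row_i v i) *m A]. *)
Lemma word_koszul_convolution n :
  \sum_(r < n.+1) word_poly (n - r) * koszul_poly r = (n == 0)%N%:R.
Proof.
have [nf [nf_alt nf_adm]] := nf_exists m k C.
apply/eqP; rewrite -subr_eq0; apply/eqP/mpoly_eq0_meval => v.
rewrite mevalB raddf_sum /= [X in _ - X]rmorph_nat.
apply/eqP; rewrite subr_eq0; apply/eqP.
rewrite -(trace_identity m_gt0 k_gt1 nf_alt nf_adm (diag_mx (\row_i v i) *m A)).
apply: eq_bigr => r _; rewrite mevalM mulrC mulrA; congr (_ * _).
  rewrite /koszul_poly; case: leqP => rm; last by rewrite meval0 mulr0.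
  by rewrite mevalZ meval_cTA mulrA.
rewrite raddf_sum; apply: eq_bigr => s adm.
rewrite [LHS]mevalZ meval_word_monomial (coeffGE nf_alt nf_adm) // act_diag.
exact: mulrC.
Qed.

Lemma koszul_sum : \sum_(r < m.+1 | (r == 0 %[mod k]) || (r == 1 %[mod k]))
    (-1) ^+ (r - r %% k)%N *: cTA A r = \sum_(r < m.+1) koszul_poly r.
Proof.
rewrite big_mkcond; apply: eq_bigr => r _.
rewrite /koszul_poly -ltnS ltn_ord /eps mod0n [(1 %% k)%N]modn_small //.
case: eqP => [->|_] /=; first by rewrite subn0 subr0 mul1r.
case: eqP => [r1|_] /=; last by rewrite subr0 mul0r scale0r.
have r_gt0 : (0 < r)%N by case: (nat_of_ord r) r1 => //; rewrite mod0n.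
(* Here $\alpha(r)=r-1$; the minus sign of [eps] accounts for the shift. *)
rewrite r1 sub0r subn1 mulN1r; congr (_ *: _).
by rewrite -[in RHS](prednK r_gt0) exprS mulN1r opprK.
Qed.

Lemma mcoeff_koszul_sum a :
  (\sum_(r < m.+1) koszul_poly r)@_a = (koszul_poly (mdeg a))@_a.
Proof.
rewrite raddf_sum /=; have [le|lt] := ltnP (mdeg a) m.+1; last first.
  rewrite {2}/koszul_poly leqNgt lt mcoeff0 big1 // => r _.
  rewrite (dhomog_nemf_coeff (koszul_poly_homog r)) //.
  by rewrite gtn_eqF // (leq_trans _ lt).
rewrite (bigD1 (Ordinal le)) //= big1 ?addr0 // => r ra.
rewrite (dhomog_nemf_coeff (koszul_poly_homog r)) //.
by apply: contraNneq ra => e; apply/eqP/val_inj.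
Qed.

Lemma word_series_koszul :
  mseries_mul (word_series (admissible k) (coeffG k A))
    (mseries_of_poly (\sum_(r < m.+1) koszul_poly r)) = mseries_one.
Proof.
apply/funext => n; rewrite /mseries_mul /mseries_one /mseries_of_poly.
have := congr1 (fun p : {mpoly C[m]} => p@_n) (word_koszul_convolution (mdeg n)).
rewrite raddf_sum /=.
have -> : ((mdeg n == 0)%N%:R : {mpoly C[m]})@_n = (n == 0%MM)%:R.
  rewrite mdeg_eq0; case: eqP => [->|_]; last exact: mcoeff0.
  by rewrite mcoeff1 eqxx.
move=> <-.
have mulE (p q : {mpoly C[m]}) : (p * q)@_n =
    \sum_(a : 'X_{1..m < (mdeg n).+1} | (bmnm a <= n)%MM) p@_a * q@_(n - bmnm a)%MM.
  exact: mcoeff_poly_mul_lin.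
under [RHS]eq_bigr => r _ do rewrite mulE.
rewrite exchange_big /=; apply: eq_bigr => a an.
have degE : (mdeg n = mdeg a + mdeg (n - bmnm a)%MM)%N.
  by rewrite -mdegD addmC submK.
have lt : (mdeg (n - bmnm a)%MM < (mdeg n).+1)%N by rewrite ltnS mdegB.
have subE : (mdeg n - mdeg (n - bmnm a)%MM = mdeg a)%N by rewrite {1}degE addnK.
(* By homogeneity, for fixed [a] only the part of degree [mdeg (n - a)] contributes. *)
rewrite (bigD1 (Ordinal lt)) //= [X in _ + X]big1 => [|r ra].
  rewrite addr0 mcoeff_koszul_sum subE; congr (_ * _).
  by rewrite /word_poly raddf_sum.
rewrite [X in _ * X](dhomog_nemf_coeff (koszul_poly_homog r)) ?mulr0 //.
by apply: contraNneq ra => e; apply/eqP/val_inj.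
Qed.

End MasterTheorem.

Unset Implicit Arguments.

Theorem theorem2 (R : realType) (m k : nat) (A : 'M[R[i]]_m)
    (hm : (2 <= m)%N) (hk : (2 <= k <= m)%N) :
  is_basis_on (admissible k) (monB (@genB R[i] m k)) /\
  mseries_mul
    (word_series (admissible k) (coeffG k A))
    (mseries_of_poly
       (\sum_(r < m.+1 | (r == 0 %[mod k]) || (r == 1 %[mod k]))
          (-1) ^+ (r - r %% k)%N *: cTA A r))
  = mseries_one.
Proof.
have /andP[k_gt1 _] := hk; have m_gt0 := ltnW hm.
have [nf [nf_alt nf_adm]] := nf_exists m k R[i].
split; first exact: admissible_basis nf_alt nf_adm.
by rewrite koszul_sum // word_series_koszul.
Qed.
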